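(* Let $P=\{p_1,\dots,p_n\}$ be a generic set of $n$ points in the plane, let $F$ be a set of pairwise non-crossing edges on $P$ that is independent in the Laman matroid on $K_n$, and assume the $F$-constrained Delaunay triangulation of $P$ is unique. Then every $F$-constrained non-crossing Laman framework $L$ on $P$ can be transformed into a constrained Delaunay Laman framework (CDLF) by at most $O(n^2)$ L-flips.
   Context: Points are identified with labels $1,\dots,n$; an edge $ij$ is the segment $p_ip_j$, and $K_n$ is the set of all such edges. A Laman graph on $\{1,\dots,n\}$ has $2n-3$ edges with every subset of $n'\ge2$ vertices spanning at most $2n'-3$ edges; these are the bases of the Laman (generic rigidity) matroid on $K_n$, whose independent sets are the edge sets in which every $n'\ge 2$ vertices span at most $2n'-3$ edges. A Laman framework on $P$ is a Laman graph drawn with vertex $i$ at $p_i$ and straight-segment edges; it is non-crossing if no two segments of non-adjacent edges share a point, and $F$-constrained if it contains $F$. Two points $a,b\in P$ are visible if no edge of $F$ properly intersects segment $ab$; segment $ab$ is visible to a point $c$ if the triangle $abc$ is not properly intersected by an edge of $F$. The $F$-constrained Delaunay triangulation (CDT) of $P$ is the triangulation containing $F$ together with exactly those edges $ab$ ($a,b\in P$) such that $a$ and $b$ are visible and some circle through $a$ and $b$ contains no point of $P$ visible to $ab$. A CDLF is an $F$-constrained Laman framework all of whose edges belong to the CDT. An L-flip is the deletion of one edge and insertion of one edge taking a Laman framework $L$ to a new Laman framework $L'$. *)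

(* Defs.v *)
From HB Require Import structures.
From mathcomp Require Import all_boot all_order all_algebra.
From mathcomp Require Import reals.

Set Implicit Arguments.
Unset Strict Implicit.
Unset Printing Implicit Defensive.

Import Order.TTheory GRing.Theory Num.Theory.
Local Open Scope ring_scope.

(* An edge ij is the two-element set {i, j} of labels; since the positions of
   the vertices are fixed by p, a framework on p is just its edge set. *)
Notation edge n := {set 'I_n}.
Notation edges n := {set {set 'I_n}}.

Definition complete_graph (n : nat) : edges n := [set e : edge n | #|e| == 2%N].

(* E ::&: S is the set of edges of E spanned by S.  The bounds 2n' - 3 are
   written additively to avoid truncated subtraction. *)
Definition laman_independent (n : nat) (E : edges n) : bool :=
  (E \subset complete_graph n) &&
  [forall S : {set 'I_n},
     (2 <= #|S|)%N ==> (#|E ::&: S| + 3 <= 2 * #|S|)%N].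

Definition laman_graph (n : nat) (E : edges n) : bool :=
  laman_independent E && (#|E| + 3 == 2 * n)%N.

Definition L_flip (n : nat) : rel (edges n) :=
  fun L L' : edges n =>
  [&& laman_graph L, laman_graph L' &
    [exists e in L, exists f in ~: L, L' == f |: (L :\ e)]].

Section Plane.
Variable R : realType.
Implicit Types a b c d o x : 'rV[R]_2.

Definition segment a b x : Prop :=
  exists t : R, 0 <= t <= 1 /\ x = (1 - t) *: a + t *: b.

Definition open_segment a b x : Prop :=
  exists t : R, 0 < t < 1 /\ x = (1 - t) *: a + t *: b.

Definition segments_properly_intersect a b c d : Prop :=
  exists! x, open_segment a b x /\ open_segment c d x.

(* The interior of the triangle abc, for a, b, c not collinear. *)
Definition triangle_interior a b c x : Prop :=
  exists u v w : R,
    [/\ 0 < u, 0 < v, 0 < w, u + v + w = 1 & x = u *: a + v *: b + w *: c].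

Definition segment_properly_intersects_triangle a b c d o : Prop :=
  exists x, segment a b x /\ triangle_interior c d o x.

Definition sqdist a b : R := \sum_(k < 2) (a 0 k - b 0 k) ^+ 2.

End Plane.

Section Frameworks.
Variables (R : realType) (n : nat) (p : 'I_n -> 'rV[R]_2).

(* The row of the edge {i, j}: p_i - p_j in the two columns of vertex i,
   p_j - p_i in those of vertex j, and 0 elsewhere (the term u = v of the sum
   vanishes). *)
Definition rigidity_row (e : edge n) : 'rV[R]_(n * 2) :=
  mxvec (\matrix_(v < n, k < 2)
    if v \in e then \sum_(u in e) (p v 0 k - p u 0 k) else 0).

Definition rigidity_matrix (E : edges n) : 'M[R]_(#|E|, n * 2) :=
  \matrix_(r < #|E|) rigidity_row (enum_val r).

Definition noncrossing (E : edges n) : Prop :=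
  forall i j k l : 'I_n,
    [set i; j] \in E -> [set k; l] \in E -> [disjoint [set i; j] & [set k; l]] ->
    ~ exists x, segment (p i) (p j) x /\ segment (p k) (p l) x.

Definition triangulation (T : edges n) : Prop :=
  [/\ T \subset complete_graph n, noncrossing T &
    forall T' : edges n,
      T' \subset complete_graph n -> noncrossing T' -> T \subset T' -> T' = T].

Variable F : edges n.

Definition visible (i j : 'I_n) : Prop :=
  forall k l : 'I_n, [set k; l] \in F ->
    ~ segments_properly_intersect (p k) (p l) (p i) (p j).

Definition visible_to (i j m : 'I_n) : Prop :=
  forall k l : 'I_n, [set k; l] \in F ->
    ~ segment_properly_intersects_triangle (p k) (p l) (p i) (p j) (p m).

Definition constrained_empty_circle (i j : 'I_n) : Prop :=
  exists (o : 'rV[R]_2) (r : R),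
    [/\ 0 < r, sqdist o (p i) = r ^+ 2, sqdist o (p j) = r ^+ 2 &
      forall m : 'I_n, visible_to i j m -> ~ (sqdist o (p m) < r ^+ 2)].

Definition constrained_Delaunay_triangulation (T : edges n) : Prop :=
  triangulation T /\
  forall i j : 'I_n, i != j ->
    ([set i; j] \in T <->
     [set i; j] \in F \/ (visible i j /\ constrained_empty_circle i j)).

Definition constrained_noncrossing_laman (L : edges n) : Prop :=
  [/\ laman_graph L, F \subset L & noncrossing L].

(* T is meant to be the F-constrained Delaunay triangulation. *)
Definition CDLF (T L : edges n) : Prop :=
  [/\ laman_graph L, F \subset L & L \subset T].

End Frameworks.

(* Genericity in the sense of rigidity theory: every edge set attains at p the
   maximal rank of its rigidity matrix over all placements.  It implies that no
   three points are collinear, and follows from algebraic independence of the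
   coordinates over the rationals. *)
Definition generic (R : realType) (n : nat) (p : 'I_n -> 'rV[R]_2) : Prop :=
  forall (E : edges n) (q : 'I_n -> 'rV[R]_2),
    E \subset complete_graph n ->
    (\rank (rigidity_matrix q E) <= \rank (rigidity_matrix p E))%N.

(* Main.v *)
(** Extend L to a maximal non-crossing set T of edges and run Lawson's edge flips
    on T: as long as an edge ab outside F lies in two faces abc, bad with d inside
    the circle abc, replace it by cd.  Each flip of T costs at most one L-flip.
    Indeed, if the flipped edge ab belongs to the current framework L, then L - ab
    has 2n - 4 edges, and some edge g of the flipped triangulation makes L - ab + g
    a Laman graph.  Otherwise every edge of that triangulation is spanned by a
    tight set of L - ab (one that spans 2n' - 3 edges); a largest tight set absorbs
    every triangle with an edge in it, hence all neighbours of its vertices, which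
    contradicts the edge count.

    There are at most n(n-1)/2 flips: call a segment ij dead if, after lifting the
    points to the paraboloid z = x^2 + y^2, it passes above an edge of T that it
    crosses.  Flips keep dead segments dead, dead segments are not edges of T,
    and the removed edge ab becomes dead.

    When no flip applies, T is the constrained Delaunay triangulation: a point m
    visible from an edge ab and inside the circle of a face at ab would, walking
    through the faces along a segment from ab to m, lie inside the circles of all
    the faces entered, including one of which m is a vertex. *)

Require Import Defs.
From HB Require Import structures.
From mathcomp Require Import all_boot all_order all_algebra.
From mathcomp Require Import boolp reals.
From mathcomp Require Import zify ring lra.

Set Implicit Arguments.
Unset Strict Implicit.
Unset Printing Implicit Defensive.

Import Order.TTheory GRing.Theory Num.Theory.

(** * The Laman matroid *)

(* Cardinals of convertible but syntactically different sets are different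
   atoms for lia. *)
Ltac card_lia :=
  repeat match goal with H : context [@card.body _ _] |- _ => revert H end;
  repeat match goal with |- context [@card.body ?T ?A] =>
    let x := fresh "c" in set x := (@card.body T A); clearbody x end;
  lia.

Section Sparsity.
Variable n : nat.
Implicit Types (I T L : edges n) (B S X Y Z : {set 'I_n}) (e g : edge n).

Definition tight I B := (1 < #|B|) && (#|I ::&: B| + 3 == 2 * #|B|).

Lemma in_induced I S e : (e \in I ::&: S) = (e \in I) && (e \subset S).
Proof. by rewrite inE. Qed.

Lemma induced_bound I S : laman_independent I -> 1 < #|S| ->
  #|I ::&: S| + 3 <= 2 * #|S|.
Proof. by case/andP=> _ /forallP/(_ S)/implyP. Qed.

Lemma laman_independent_card I e : laman_independent I -> e \in I -> #|e| = 2.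
Proof. by case/andP=> /subsetP sI _ /sI; rewrite inE => /eqP. Qed.

Lemma laman_independent_sub I I' : I' \subset I -> laman_independent I ->
  laman_independent I'.
Proof.
move=> sI /andP[sK /forallP b]; apply/andP; split; first exact: subset_trans sK.
apply/forallP=> S; apply/implyP=> S2.
apply: leq_trans (implyP (b S) S2); rewrite leq_add2r.
by rewrite -!setI_powerset; apply: subset_leq_card; apply: setSI.
Qed.

Lemma induced_small I S : laman_independent I -> #|S| <= 1 -> I ::&: S = set0.
Proof.
move=> indI S1; apply/setP=> e; rewrite in_induced inE.
apply/negP=> /andP[eI /subset_leq_card]; rewrite (laman_independent_card indI eI); card_lia.
Qed.

Lemma disjoint_induced I X Y : laman_independent I -> #|X :&: Y| <= 1 ->
  [disjoint I ::&: X & I ::&: Y].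
Proof.
move=> indI XY1; rewrite -setI_eq0 -!setI_powerset; apply/eqP.
by rewrite -setIIr -powersetI setI_powerset induced_small.
Qed.

(** Supermodularity: an edge spanned by X and by Y is spanned by their intersection. *)
Lemma leq_card_induced2 I X Y :
  #|I ::&: X| + #|I ::&: Y| <= #|I ::&: (X :|: Y)| + #|I ::&: (X :&: Y)|.
Proof.
rewrite -!setI_powerset -cardsUI -setIIr -powersetI leq_add2r.
rewrite subset_leq_card // subUset !setIS ?powersetS ?subsetUl ?subsetUr //.
Qed.

(** The bound 2x - 3 is modular and the spanned count supermodular: as the intersection obeys its
    own bound, the union must reach its bound. *)
Lemma tightU I X Y : laman_independent I -> tight I X -> tight I Y ->
  1 < #|X :&: Y| -> tight I (X :|: Y).
Proof.
move=> indI /andP[X2 /eqP tX] /andP[Y2 /eqP tY] XY2.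
have cUI := cardsUI X Y; have sup := leq_card_induced2 I X Y.
have bI := induced_bound indI XY2.
have le2 : 1 < #|X :|: Y| by apply: leq_trans X2 (subset_leq_card (subsetUl _ _)).
have bU := induced_bound indI le2.
rewrite /tight le2 /=; card_lia.
Qed.

(* The union has x + y + z - 3 vertices, and 2(x + y + z - 3) - 3 is the sum of
   2x - 3, 2y - 3 and 2z - 3. *)
Lemma tightU3 I X Y Z a b v : laman_independent I ->
  tight I X -> tight I Y -> tight I Z ->
  X :&: Y = [set b] -> X :&: Z = [set v] -> Y :&: Z = [set a] -> a != v ->
  tight I (X :|: Y :|: Z).
Proof.
move=> indI /andP[X2 /eqP tX] /andP[Y2 /eqP tY] /andP[Z2 /eqP tZ] XY XZ YZ av.
have c1 := cardsUI X Y; have c2 := cardsUI (X :|: Y) Z.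
have d1 : [disjoint I ::&: X & I ::&: Y] by rewrite disjoint_induced // XY cards1.
have d2 : [disjoint I ::&: X & I ::&: Z] by rewrite disjoint_induced // XZ cards1.
have d3 : [disjoint I ::&: Y & I ::&: Z] by rewrite disjoint_induced // YZ cards1.
have le2 : 1 < #|X :|: Y :|: Z| by apply: leq_trans Z2 (subset_leq_card (subsetUr _ _)).
have b3 := induced_bound indI le2.
rewrite setIUl XZ YZ cards2 eq_sym av in c2; rewrite XY cards1 in c1.
have : #|I ::&: X| + #|I ::&: Y| + #|I ::&: Z| <= #|I ::&: (X :|: Y :|: Z)|.
  rewrite -(cardsUI (I ::&: X)) (disjoint_setI0 d1) cards0 addn0.
  rewrite -cardsUI setIUl (disjoint_setI0 d2) (disjoint_setI0 d3) setU0 cards0 addn0.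
  rewrite subset_leq_card // -!setI_powerset !subUset !setIS ?powersetS //.
  - exact: subsetUr.
  - by rewrite -setUA setUCA subsetUl.
  - by rewrite -setUA subsetUl.
rewrite /tight le2 /=; card_lia.
Qed.

(** Adding e raises the count only of sets containing e, and by one; a set that now violates its
    bound had reached it before. *)
Lemma dependent_tight I e : laman_independent I -> #|e| = 2 -> e \notin I ->
  ~~ laman_independent (e |: I) -> exists2 B, tight I B & e \subset B.
Proof.
move=> indI e2 eI; case/nandP.
  case/negP; rewrite subUset; apply/andP; split; first by rewrite sub1set inE e2.
  by case/andP: indI.
case/forallPn=> S; rewrite negb_imply -ltnNge => /andP[S2 big].
have bS := induced_bound indI S2.
have le1 : #|(e |: I) ::&: S| <= #|I ::&: S| + (e \subset S).
  rewrite -!setI_powerset setIUl; apply: leq_trans (leq_card_setU _ _) _.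
  rewrite addnC leq_add2l; case: (boolP (e \subset S)) => eS /=.
    by apply: leq_trans (subset_leq_card (subsetIl _ _)) _; rewrite cards1.
  rewrite leqn0 cards_eq0; apply/eqP/setP=> x; rewrite !inE.
  by apply/negP=> /andP[/eqP->]; apply/negP.
move: le1; case: (boolP (e \subset S)) => eS /= le1; last by card_lia.
exists S; rewrite // /tight S2 /=; card_lia.
Qed.

Lemma edge_tight I e : laman_independent I -> e \in I -> tight I e.
Proof.
move=> indI eI; have e2 := laman_independent_card indI eI.
have := @induced_bound I e indI; rewrite /tight e2 => /(_ isT) b.
have : 0 < #|I ::&: e| by apply/card_gt0P; exists e; rewrite in_induced eI subxx.
card_lia.
Qed.

(** Without a neighbour of v in B, removing v from B would lose no spanned edge while lowering the
    bound. *)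
Lemma tight_neighbour I B v : laman_independent I -> tight I B -> v \in B ->
  exists2 a, a \in B & [set v; a] \in I.
Proof.
move=> indI /andP[B2 /eqP tB] vB.
case: (pickP [pred a in B | [set v; a] \in I]) => [a /andP[]|no]; first by exists a.
suff : #|I ::&: B| <= #|I ::&: (B :\ v)|.
  have := cardsD1 v B; rewrite vB => cB.
  case: (ltnP 1 #|B :\ v|) => [/(induced_bound indI)|B1]; first by card_lia.
  rewrite (induced_small indI B1) cards0; card_lia.
apply/subset_leq_card/subsetP=> e; rewrite !in_induced => /andP[eI eB].
rewrite eI subsetD1 eB /=; apply/negP=> ve.
have /cards2P[x [y [xy eE]]] : #|e| == 2 by rewrite (laman_independent_card indI eI).
move: ve eI eB; rewrite eE !inE subUset !sub1set => /orP[] /eqP vE eI /andP[xB yB].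
  by have := no y; rewrite /= yB vE eI.
by have := no x; rewrite /= xB vE setUC eI.
Qed.

(** The last hypothesis says that a set closed under the triangles of T contains all neighbours of
    each of its vertices that has a neighbour in it; [star_connected] supplies it for
    triangulations. *)
Lemma laman_augment I T :
  2 < n -> laman_independent I -> #|I| + 4 = 2 * n -> I \subset T ->
  T \subset complete_graph n ->
  (forall B v a b,
     (forall v' a' b', v' \in B -> a' \in B -> [set v'; a'] \in T ->
        [set v'; b'] \in T -> [set a'; b'] \in T -> b' \in B) ->
     v \in B -> a \in B -> [set v; a] \in T -> [set v; b] \in T -> b \in B) ->
  exists2 g, g \in T :\: I & laman_independent (g |: I).
Proof.
move=> n3 indI cI sIT sTK star.
case: (pickP [pred g in T :\: I | laman_independent (g |: I)]) => [g /andP[]|no]; first by exists g.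
exfalso.
have T2 e : e \in T -> #|e| = 2 by move/(subsetP sTK); rewrite inE => /eqP.
have spanned e : e \in T -> exists2 B, tight I B & e \subset B.
  move=> eT; case: (boolP (e \in I)) => eI; first by exists e; rewrite ?edge_tight.
  apply: dependent_tight => //; first exact: T2.
  by have := no e; rewrite /= inE eI eT /= => ->.
have [e0 e0I] : exists e0, e0 \in I.
  by case: (set_0Vmem I) => [E|[e eI]]; [move: cI; rewrite E cards0; lia | exists e].
pose B := [arg max_(B > e0 | tight I B) #|B|].
have [tB maxB] : tight I B /\ forall X, tight I X -> #|X| <= #|B|.
  by rewrite /B; case: arg_maxnP; first exact: edge_tight.
have absorb X : tight I X -> 1 < #|X :&: B| -> X \subset B.
  move=> tX XB; have := maxB _ (tightU indI tX tB XB); rewrite setUC => le.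
  have /eqP-> : B == B :|: X by rewrite eqEcard subsetUl.
  exact: subsetUr.
have meet1 X x y : tight I X -> x \in X -> x \in B -> y \in X -> y \notin B ->
    X :&: B = [set x].
  move=> tX xX xB yX yB; apply/eqP; rewrite eq_sym eqEcard sub1set inE xX xB cards1.
  rewrite leqNgt; apply/negP=> /(absorb _ tX)/subsetP/(_ _ yX); exact/negP.
(* The tight sets X around vb and Y around ab either share two vertices, and then their union is
   tight and meets B in both a and v, or X, Y and B meet pairwise in single vertices and [tightU3]
   applies. Both contradict the maximality of B. *)
have clB v a b : v \in B -> a \in B -> [set v; a] \in T ->
    [set v; b] \in T -> [set a; b] \in T -> b \in B.
  move=> vB aB /T2 va /spanned[X tX]; rewrite subUset !sub1set => /andP[vX bX].
  case/spanned=> [Y tY]; rewrite subUset !sub1set => /andP[aY bY].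
  apply/negPn/negP=> bB.
  have av : a != v by apply: contra_eqN va => /eqP->; rewrite setUid cards1.
  have XB := meet1 X v b tX vX vB bX bB; have YB := meet1 Y a b tY aY aB bY bB.
  case: (ltnP 1 #|X :&: Y|) => XY.
    have tXY := tightU indI tX tY XY.
    have : X :|: Y \subset B.
      by apply: absorb tXY _; rewrite setIUl XB YB cards2 eq_sym av.
    by rewrite subUset => /andP[/subsetP/(_ b bX)]; rewrite (negPf bB).
  have XYb : X :&: Y = [set b].
    by apply/eqP; rewrite eq_sym eqEcard sub1set inE bX bY cards1.
  have le := maxB _ (tightU3 indI tX tY tB XYb XB YB av).
  have /eqP E : B == X :|: Y :|: B by rewrite eqEcard subsetUr le.
  by move: bB; rewrite E !inE bX.
have cross e v u : e \in I -> v \in e -> u \in e -> v \in B -> u \in B.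
  move=> eI ve ue vB; case: (eqVneq v u) => [<- //|vu].
  have [a aB vaI] := tight_neighbour indI tB vB.
  have -> // : u \in B; apply: (star B v a u clB vB aB); first exact: (subsetP sIT).
  have <- : e = [set v; u]; last exact: (subsetP sIT).
  apply/eqP; rewrite eq_sym eqEcard subUset !sub1set ve ue cards2 vu.
  by rewrite (laman_independent_card indI eI).
(* No edge of I leaves B. With b vertices in B and at least two outside, I has at most (2b - 3) +
   (2(n - b) - 3) < 2n - 4 edges; with one outside, at most 2(n - 1) - 3, again too few; with none,
   B spans 2n - 3, too many. *)
have split : #|I| <= #|I ::&: B| + #|I ::&: ~: B|.
  apply: leq_trans (leq_card_setU _ _); apply/subset_leq_card/subsetP=> e eI.
  rewrite inE !in_induced eI /=.
  case: (boolP (e \subset ~: B)) => eB; first by rewrite orbT.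
  rewrite orbF; apply/subsetP=> u ue; case/subsetPn: eB => v ve; rewrite inE negbK.
  by move=> vB; apply: cross eI ve ue vB.
have := cardsC B; rewrite card_ord => cB.
case/andP: tB => B2 /eqP tB.
case: (ltnP 1 #|~: B|) => [/(induced_bound indI)|B1]; first by card_lia.
have := induced_small indI B1 => E; rewrite E cards0 in split.
case: (eqVneq #|~: B| 0) => [B0|]; last by card_lia.
have : #|I ::&: B| <= #|I| by rewrite -setI_powerset; apply/subset_leq_card/subsetIl.
card_lia.
Qed.

End Sparsity.

Local Open Scope ring_scope.

(** * Plane geometry *)

Section Plane.
Variable R : realType.
Implicit Types (a b c d q u v w x : 'rV[R]_2) (s t : R).

(** Twice the signed area of the triangle abc, positive when abc is counterclockwise. *)
Definition orient a b c : R :=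
  (b 0 0 - a 0 0) * (c 0 1 - a 0 1) - (c 0 0 - a 0 0) * (b 0 1 - a 0 1).

Lemma rV2_eq a b : a 0 0 = b 0 0 -> a 0 1 = b 0 1 -> a = b.
Proof.
move=> e0 e1; apply/rowP=> k; case: (eqVneq k 0) => [-> //|k0].
by have -> : k = 1 by apply/val_inj; case: k k0 => [[|[|]]].
Qed.

Lemma orient_lerp u v a b t :
  orient u v ((1 - t) *: a + t *: b) = (1 - t) * orient u v a + t * orient u v b.
Proof. rewrite /orient !mxE; ring. Qed.

Lemma orient_rot a b c : orient a b c = orient b c a.
Proof. rewrite /orient; ring. Qed.

Lemma orient_swap a b c : orient b a c = - orient a b c.
Proof. rewrite /orient; ring. Qed.

Lemma orient_sum a b c q : orient a b q + orient b c q + orient c a q = orient a b c.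
Proof. rewrite /orient; ring. Qed.

Lemma orient_xx a b : (orient a b a = 0) * (orient a b b = 0) * (orient a a b = 0).
Proof. by do !split; rewrite /orient; ring. Qed.

Lemma segmentC a b q : segment a b q -> segment b a q.
Proof.
case=> t [t01 ->]; exists (1 - t); split; first by lra.
by rewrite addrC; congr (_ *: _ + _ *: _); ring.
Qed.

Lemma segment_orient a b q : segment a b q -> orient a b q = 0.
Proof. by case=> t [_ ->]; rewrite orient_lerp !orient_xx; ring. Qed.

Lemma lerp_lerp a b s t :
  (1 - t) *: ((1 - s) *: a + s *: b) + t *: a = (1 - s * (1 - t)) *: a + (s * (1 - t)) *: b.
Proof. by apply/rowP=> k; rewrite !mxE; ring. Qed.

Lemma segment_trans a b q r : segment a b q -> segment q a r -> segment a b r.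
Proof.
case=> s [s01 ->] [t [t01 ->]]; exists (s * (1 - t)); split; last exact: lerp_lerp.
by nra.
Qed.

Lemma triangle_side u v w q : 0 < orient u v w -> orient u v q = 0 ->
  0 <= orient v w q -> 0 <= orient w u q -> segment u v q.
Proof.
move=> D0 q0 qv qw; have S := orient_sum u v w q.
(* The parameter is the barycentric coordinate of q at v. *)
exists (orient w u q / orient u v w); split.
  by apply/andP; split; [apply: divr_ge0 => //; apply: ltW | rewrite ler_pdivrMr //; lra].
have E (k : 'I_2) : q 0 k * orient u v w =
    orient v w q * u 0 k + orient w u q * v 0 k + orient u v q * w 0 k.
  case: (eqVneq k 0) => [->|k0]; first by rewrite /orient; ring.
  have -> : k = 1 by apply/val_inj; case: k k0 => [[|[|]]].
  by rewrite /orient; ring.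
by apply/rowP=> k; rewrite !mxE; have := E k; rewrite q0 => Ek; apply: (mulIf (lt0r_neq0 D0));
  rewrite Ek; have -> : orient v w q = orient u v w - orient w u q; [lra | field; rewrite lt0r_neq0].
Qed.

Lemma exit_step (q h t : R) : 0 <= q -> 0 <= t <= 1 ->
  0 <= (1 - t) * q + t * h \/
  exists t', [/\ 0 <= t' <= t, (1 - t') * q + t' * h = 0 & h < 0].
Proof.
move=> q0 t01; case: (lerP 0 ((1 - t) * q + t * h)) => [|neg]; [by left | right].
have h0 : h < 0 by nra.
have d0 : 0 < q - h by lra.
exists (q / (q - h)); split=> //; last by field; rewrite lt0r_neq0.
by apply/andP; split; [apply: divr_ge0 => //; apply: ltW | rewrite ler_pdivrMr //; nra].
Qed.

Lemma exit_mono (q h t t' : R) : 0 <= q -> t <= 1 -> 0 <= (1 - t) * q + t * h ->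
  0 <= t' <= t -> 0 <= (1 - t') * q + t' * h.
Proof.
move=> q0 t1 f0 t't; case: (lerP 0 h) => h0; first by nra.
by nra.
Qed.

(* The first parameter at which a ray leaves an intersection of three half-planes. *)
Lemma exit3 (q1 q2 q3 h1 h2 h3 : R) : 0 <= q1 -> 0 <= q2 -> 0 <= q3 ->
  [\/ h1 < 0, h2 < 0 | h3 < 0] ->
  exists t, [/\ 0 <= t <= 1,
    [/\ 0 <= (1 - t) * q1 + t * h1, 0 <= (1 - t) * q2 + t * h2 &
        0 <= (1 - t) * q3 + t * h3] &
    [\/ (1 - t) * q1 + t * h1 = 0 /\ h1 < 0,
        (1 - t) * q2 + t * h2 = 0 /\ h2 < 0 |
        (1 - t) * q3 + t * h3 = 0 /\ h3 < 0]].
Proof.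
move=> q10 q20 q30 neg.
pose Z t := [\/ (1 - t) * q1 + t * h1 = 0 /\ h1 < 0,
        (1 - t) * q2 + t * h2 = 0 /\ h2 < 0 |
        (1 - t) * q3 + t * h3 = 0 /\ h3 < 0].
(* The parameter starts at 1 and is lowered to a zero of each function that is negative there, one
   function after the other; [exit_mono] keeps the signs already obtained. *)
have [t1 [t101 f1 Z1]] : exists t, [/\ 0 <= t <= 1, 0 <= (1 - t) * q1 + t * h1 & t = 1 \/ Z t].
  have i1 : 0 <= (1 : R) <= 1 by lra.
  case: (exit_step h1 q10 i1) => [f|[t [t01 f h]]]; first by exists 1; split=> //; left.
  by exists t; split=> //; [rewrite f | right; constructor 1].
have [t2 [t201 f21 f22 Z2]] : exists t, [/\ 0 <= t <= 1, 0 <= (1 - t) * q1 + t * h1,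
    0 <= (1 - t) * q2 + t * h2 & t = 1 \/ Z t].
  case: (exit_step h2 q20 t101) => [f|[t [t01 f h]]]; first by exists t1; split.
  exists t; split; [lra | | by rewrite f | by right; constructor 2].
  by apply: exit_mono f1 t01 => //; lra.
have [t3 [t301 f31 f32 f33 Z3]] : exists t, [/\ 0 <= t <= 1, 0 <= (1 - t) * q1 + t * h1,
    0 <= (1 - t) * q2 + t * h2, 0 <= (1 - t) * q3 + t * h3 & t = 1 \/ Z t].
  case: (exit_step h3 q30 t201) => [f|[t [t01 f h]]]; first by exists t2; split.
  exists t; split; [lra | | | by rewrite f | by right; constructor 3].
  - by apply: exit_mono f21 t01 => //; lra.
  - by apply: exit_mono f22 t01 => //; lra.
exists t3; split=> //; case: Z3 => // E; exfalso; rewrite E in f31 f32 f33.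
by case: neg => ?; lra.
Qed.

Lemma triangle_exit u v w q h : 0 < orient u v w ->
  0 <= orient u v q -> 0 <= orient v w q -> 0 <= orient w u q ->
  [\/ orient u v h < 0, orient v w h < 0 | orient w u h < 0] ->
  exists t, let r := (1 - t) *: q + t *: h in 0 <= t <= 1 /\
    [\/ segment u v r /\ orient u v h < 0, segment v w r /\ orient v w h < 0 |
        segment w u r /\ orient w u h < 0].
Proof.
move=> D q1 q2 q3 neg.
have [t [t01 [f1 f2 f3] Z]] := exit3 q1 q2 q3 neg.
move: f1 f2 f3 Z; rewrite -!orient_lerp => f1 f2 f3 Z.
have D2 : 0 < orient v w u by rewrite -orient_rot.
have D3 : 0 < orient w u v by rewrite orient_rot.
exists t; split=> //; case: Z => -[E lt].
- by constructor 1; split=> //; apply: (triangle_side D).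
- by constructor 2; split=> //; apply: (triangle_side D2).
- by constructor 3; split=> //; apply: (triangle_side D3).
Qed.

End Plane.

Section FiniteExtrema.
Variables (R : realType) (I : finType).

Lemma ex_max (P : I -> Prop) (f : I -> R) (i0 : I) : P i0 ->
  exists i, P i /\ forall j, P j -> f j <= f i.
Proof.
move=> Pi0; have P0 : `[< P i0 >] by apply/asboolP.
case: (@Order.TotalTheory.arg_maxP _ _ _ i0 (fun i => `[< P i >]) f P0) => i /asboolP Pi maxi.
by exists i; split=> // j Pj; apply: maxi; apply/asboolP.
Qed.

Lemma ex_min (P : I -> Prop) (f : I -> R) (i0 : I) : P i0 ->
  exists i, P i /\ forall j, P j -> f i <= f j.
Proof.
move=> /(ex_max (fun i => - f i))[i [Pi maxi]]; exists i; split=> // j /maxi.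
by rewrite lerN2.
Qed.

End FiniteExtrema.

(** * Maximal non-crossing edge sets *)

Lemma set2_eq (T : finType) (i j k l : T) : [set i; j] = [set k; l] ->
  i = k /\ j = l \/ i = l /\ j = k.
Proof.
move=> E; have : i \in [set k; l] by rewrite -E !inE eqxx.
have : j \in [set k; l] by rewrite -E !inE eqxx orbT.
have : k \in [set i; j] by rewrite E !inE eqxx.
have : l \in [set i; j] by rewrite E !inE eqxx orbT.
rewrite !inE => /orP[] /eqP-> /orP[] /eqP-> /orP[] /eqP ? /orP[] /eqP ?; subst; by [left|right].
Qed.

Lemma disjoint_set2 (T : finType) (i j k l : T) :
  [disjoint [set i; j] & [set k; l]] = [&& i != k, i != l, j != k & j != l].
Proof.
by rewrite -setI_eq0 setIUl setU_eq0 !setI_eq0 !disjoints1 !inE !negb_or -andbA.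
Qed.

Definition general_position (R : realType) n (p : 'I_n -> 'rV[R]_2) :=
  forall i j k, i != j -> j != k -> i != k -> orient (p i) (p j) (p k) != 0.

Section Triangulations.
Variables (R : realType) (n : nat) (p : 'I_n -> 'rV[R]_2).
Hypothesis gp : general_position p.
Implicit Types (T : edges n).

Local Notation o i j k := (orient (p i) (p j) (p k)).

Lemma edge_neq T i j : T \subset complete_graph n -> [set i; j] \in T -> i != j.
Proof. by move=> /subsetP sT /sT; rewrite inE cards2; case: (i != j). Qed.

Lemma vertex_on_segment i j k : i != j -> segment (p i) (p j) (p k) -> k = i \/ k = j.
Proof.
move=> ij /segment_orient E; case: (eqVneq k i) => [|ki]; first by left.
case: (eqVneq k j) => [|kj]; first by right.
by have := @gp i j k ij; rewrite (eq_sym j) (eq_sym i k) E eqxx => /(_ kj ki).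
Qed.

Lemma shared_endpoint i j l q : i != j -> i != l -> j != l ->
  segment (p i) (p j) q -> segment (p i) (p l) q -> q = p i.
Proof.
move=> ij il jl /segment_orient E [t [t01 qE]].
move: E; rewrite qE orient_lerp !orient_xx mulr0 add0r => /eqP.
rewrite mulf_eq0 (negPf (gp ij jl il)) orbF => /eqP->.
by rewrite subr0 scale1r scale0r addr0.
Qed.

Lemma segment_set2 i j k l q : [set i; j] = [set k; l] ->
  segment (p i) (p j) q -> segment (p k) (p l) q.
Proof. by case/set2_eq=> -[-> ->] //; apply: segmentC. Qed.

(** [noncrossing] constrains only non-adjacent edges; for adjacent ones general position confines
    the common points to the shared endpoint. *)
Lemma edges_meet T i j k l q : T \subset complete_graph n -> noncrossing p T ->
  [set i; j] \in T -> [set k; l] \in T ->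
  segment (p i) (p j) q -> segment (p k) (p l) q ->
  [set i; j] = [set k; l] \/
  exists v, [/\ v = i \/ v = j, v = k \/ v = l & q = p v].
Proof.
move=> sT nc ijT klT sij skl.
case: (boolP [disjoint [set i; j] & [set k; l]]) => [d|].
  by case: (nc _ _ _ _ ijT klT d); exists q.
have ij := edge_neq sT ijT; have kl := edge_neq sT klT.
have key i' j' k' l' : i' = k' -> i' != j' -> k' != l' -> segment (p i') (p j') q ->
    segment (p k') (p l') q -> [set i'; j'] = [set k'; l'] \/ q = p i'.
  move=> <- ij' kl' s1 s2; case: (eqVneq j' l') => [->|jl]; first by left.
  by right; apply: shared_endpoint s1 s2.
have sji := segmentC sij; have slk := segmentC skl.
have ji : j != i by rewrite eq_sym. have lk : l != k by rewrite eq_sym.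
rewrite disjoint_set2 !negb_and !negbK => /or4P[] /eqP E.
- case: (key i j k l) => // [|->]; [by left | right].
  by exists i; split=> //; left.
- case: (key i j l k) => // [H|->]; [by left; rewrite H setUC | right].
  by exists i; split; [left | right |].
- case: (key j i k l) => // [H|->]; [by left; rewrite setUC | right].
  by exists j; split; [right | left |].
- case: (key j i l k) => // [H|->]; [by left; rewrite setUC H setUC | right].
  by exists j; split; [right | right |].
Qed.

Lemma triangulation_crossed T i j : triangulation p T -> i != j -> [set i; j] \notin T ->
  exists k l q, [/\ [set k; l] \in T, [disjoint [set i; j] & [set k; l]],
    segment (p i) (p j) q & segment (p k) (p l) q].
Proof.
move=> [sT nc maxT] ij; apply: contraNP => no.
have <- : [set i; j] |: T = T; last by rewrite !inE eqxx.
apply: maxT; last exact: subsetUr.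
  by rewrite subUset sT sub1set inE cards2 ij.
have bad a b c d q : [set a; b] = [set i; j] -> [set c; d] \in T ->
    [disjoint [set a; b] & [set c; d]] -> segment (p a) (p b) q ->
    segment (p c) (p d) q -> False.
  move=> E cdT dis s1 s2; apply: no; exists c, d, q; split=> //; first by rewrite -E.
  exact: segment_set2 E s1.
move=> a b c d; rewrite !in_setU1 => /orP[/eqP E1|T1] /orP[/eqP E2|T2] dis [q [s1 s2]].
- by move: dis; rewrite E1 E2 -setI_eq0 setIid => /eqP/setP/(_ i); rewrite !inE eqxx.
- exact: bad s1 s2.
- by apply: (bad c d a b q) => //; rewrite disjoint_sym.
- by apply: (nc a b c d) => //; exists q.
Qed.

Lemma triangulation_extend (E : edges n) : E \subset complete_graph n -> noncrossing p E ->
  exists2 T, triangulation p T & E \subset T.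
Proof.
move=> sE ncE.
pose good (T : edges n) := `[< [/\ T \subset complete_graph n, noncrossing p T & E \subset T] >].
have gE : good E by apply/asboolP.
case: (@arg_maxnP _ E good (fun T => #|T|) gE) => T /asboolP[sT ncT ET] maxT.
exists T => //; split=> // T' sT' ncT' TT'; apply/eqP; rewrite eq_sym eqEcard TT' /=.
by apply: maxT; apply/asboolP; split=> //; apply: subset_trans TT'.
Qed.

Definition empty_triangle a b c :=
  forall w, ~ [/\ 0 < o a b w, 0 < o b c w & 0 < o c a w].

(** * Two neighbours of v with no neighbour in the angle between them *)

Section Cone.
Variables (T : edges n) (v a b : 'I_n).
Hypotheses (triT : triangulation p T) (vab : 0 < o v a b).
Hypotheses (vaT : [set v; a] \in T) (vbT : [set v; b] \in T).
Hypothesis no_nbr : forall w, [set v; w] \in T -> 0 < o v a w -> 0 < o b v w -> False.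

(** Since y is on the inner side of ab, the way from x to y along yz can leave the triangle vab only
    through va or vb. These are edges of T, so yz would meet them at a corner of the triangle, and
    the hypotheses exclude every corner. *)
Let cone_exit y z x : [set y; z] \in T -> v != y -> v != z -> segment (p y) (p z) x ->
  0 < o a b y -> 0 < orient (p v) (p a) x -> 0 < orient (p b) (p v) x ->
  0 <= orient (p a) (p b) x ->
  0 < orient (p a) (p b) x \/ a != z /\ b != z ->
  0 < o v a y /\ 0 < o b v y.
Proof.
move=> yzT vy vz sx aby vax bvx abx pos.
have [sT nc _] := triT.
have va := edge_neq sT vaT; have bv : b != v by rewrite eq_sym (edge_neq sT vbT).
have ay : a != y by apply: contraTneq aby => <-; rewrite orient_xx ltxx.
have yb : b != y by apply: contraTneq aby => <-; rewrite orient_xx ltxx.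
have vay0 : o v a y != 0 by apply: gp.
have bvy0 : o b v y != 0 by apply: gp.
apply/andP; apply/negPn/negP; rewrite negb_and -!leNgt => le.
have [||||t] := @triangle_exit _ (p v) (p a) (p b) x (p y) vab; [lra|lra|lra| |].
  by case/orP: le => le; [constructor 1 | constructor 3]; rewrite lt_neqAle ?vay0 ?bvy0.
move=> [t01]; set r := _ + _ => side.
have sr : segment (p y) (p z) r by apply: segment_trans sx _; exists t.
have no_corner u : a = u \/ b = u -> u = y \/ u = z -> r = p u -> False.
  move=> ab_u yz_u rE.
  have : orient (p a) (p b) r = 0 by rewrite rE; case: ab_u => <-; rewrite orient_xx.
  rewrite orient_lerp; case: pos => [pos|[az bz]]; first by nra.
  by move: yz_u az bz ay yb; case: ab_u => -> [] ->; rewrite eqxx.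
case: side => -[sv neg]; last 2 first.
- by lra.
- case: (edges_meet sT nc yzT vbT sr (segmentC sv)) => [/set2_eq|[u []]].
    by case=> -[E1 E2]; move: vy vz; rewrite ?E1 ?E2 eqxx.
  move=> yzu [E|E] rE; last by apply: (no_corner u) => //; right.
  by case: yzu => E'; move: vy vz; rewrite -E E' eqxx.
- case: (edges_meet sT nc yzT vaT sr sv) => [/set2_eq|[u []]].
    by case=> -[E1 E2]; move: vy vz; rewrite ?E1 ?E2 eqxx.
  move=> yzu [E|E] rE; last by apply: (no_corner u) => //; left.
  by case: yzu => E'; move: vy vz; rewrite -E E' eqxx.
Qed.

(* Take the point w inside the triangle that is farthest from ab: an edge
   crossing vw would have an endpoint inside the triangle still farther from ab. *)
Lemma cone_empty : empty_triangle v a b.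
Proof.
move=> w0 in0.
have [sT nc _] := triT.
have [w [[vaw abw bvw] maxw]] :=
  @ex_max R _ (fun w => [/\ 0 < o v a w, 0 < o a b w & 0 < o b v w]) (fun w => o a b w) w0 in0.
have vw : v != w by apply: contraTneq vaw => <-; rewrite orient_xx ltxx.
have vwT : [set v; w] \notin T by apply/negP=> vwT; apply: (no_nbr vwT).
have [y [z [x [yzT]]]] := triangulation_crossed triT vw vwT.
rewrite disjoint_set2 => /and4P[vy vz wy wz] [s [s01 xE]] sx.
have yz := edge_neq sT yzT.
have s_gt0 : 0 < s.
  rewrite lt_neqAle (andP s01).1 andbT; apply: contraTneq isT => s0.
  move: sx; rewrite xE -s0 subr0 scale1r scale0r addr0.
  by case/(vertex_on_segment yz) => E; move: vy vz; rewrite E eqxx.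
have s_lt1 : s < 1.
  rewrite lt_neqAle (andP s01).2 andbT; apply: contraTneq isT => s1.
  move: sx; rewrite xE s1 subrr scale1r scale0r add0r.
  by case/(vertex_on_segment yz) => E; move: wy wz; rewrite E eqxx.
have vax : 0 < orient (p v) (p a) x by rewrite xE orient_lerp orient_xx; nra.
have bvx : 0 < orient (p b) (p v) x by rewrite xE orient_lerp orient_xx; nra.
have abx : o a b w < orient (p a) (p b) x.
  have ltD : o a b w < o a b v by rewrite -(orient_rot (p v)) -(orient_sum (p v) (p a) (p b) (p w)); lra.
  by rewrite xE orient_lerp; nra.
have key y' z' : [set y'; z'] \in T -> v != y' -> v != z' -> segment (p y') (p z') x ->
    o a b w < o a b y' -> False.
  move=> yzT' vy' vz' sx' lt.
  have ab0 : 0 < o a b y' by lra.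
  have abx0 : 0 < orient (p a) (p b) x by lra.
  have [i1 i2] := cone_exit yzT' vy' vz' sx' ab0 vax bvx (ltW abx0) (or_introl abx0).
  have := maxw y'.
  by move=> /(_ (And3 i1 ab0 i2)); rewrite leNgt lt.
have : o a b w < o a b y \/ o a b w < o a b z.
  case: (ltrP (o a b w) (o a b y)) => [|le1]; first by left.
  case: (ltrP (o a b w) (o a b z)) => [|le2]; first by right.
  by case: sx abx => t [t01 ->]; rewrite orient_lerp; nra.
case=> lt; first exact: (key y z).
by apply: (key z y) => //; [rewrite setUC | apply: segmentC].
Qed.

(** An edge crossing ab has an endpoint on the side of v. If that is v, the other endpoint is a
    neighbour of v in the angle; otherwise [cone_exit] places it inside the triangle, against
    [cone_empty]. *)
Lemma cone_closing_edge : [set a; b] \in T.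
Proof.
have [sT nc _] := triT.
have ab : a != b by apply: contraTneq vab => ->; rewrite orient_xx ltxx.
apply/negPn/negP=> abT.
have [k [l [x [klT]]]] := triangulation_crossed triT ab abT.
rewrite disjoint_set2 => /and4P[ak al bk bl] sxab sx.
have kl := edge_neq sT klT.
have abk0 : o a b k != 0 by apply: gp.
have abl0 : o a b l != 0 by apply: gp.
have abx := segment_orient sxab.
have abv : 0 < o a b v by rewrite -orient_rot.
have [vax bvx] : 0 < orient (p v) (p a) x /\ 0 < orient (p b) (p v) x.
  have not_end u : u = a \/ u = b -> x = p u -> False.
    move=> uab xE; move: sx; rewrite xE => /(vertex_on_segment kl).
    by case: uab => -> [] E; move: ak al bk bl; rewrite E eqxx.
  case: sxab not_end => t [t01 ->] not_end; rewrite !orient_lerp !orient_xx.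
  have bva : 0 < o b v a by rewrite orient_rot.
  have t0 : t != 0.
    by apply/eqP=> t0; apply: (not_end a); [left | rewrite t0 subr0 scale1r scale0r addr0].
  have t1 : t != 1.
    by apply/eqP=> t1; apply: (not_end b); [right | rewrite t1 subrr scale1r scale0r add0r].
  have t_gt0 : 0 < t by rewrite lt_neqAle eq_sym t0 (andP t01).1.
  have t_lt1 : 0 < 1 - t by rewrite subr_gt0 lt_neqAle t1 (andP t01).2.
  by rewrite !mulr0 add0r addr0 !mulr_gt0.
have key k' l' : [set k'; l'] \in T -> a != k' -> a != l' -> b != k' -> b != l' ->
    segment (p k') (p l') x -> 0 < o a b k' -> False.
  move=> klT' ak' al' bk' bl' sx' abk'.
  have vl : v != l'.
    apply/eqP=> E; move: abx; case: sx' => t [t01 ->].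
    by rewrite orient_lerp -E => abx'; nra.
  case: (eqVneq v k') => [E|vk].
    move: sx' vax bvx klT'; rewrite -E => -[t [t01 ->]].
    rewrite !orient_lerp !orient_xx !mulr0 !add0r => vax bvx vlT.
    by apply: (no_nbr vlT); nra.
  have abx0 : 0 <= orient (p a) (p b) x by rewrite abx.
  have [i1 i2] := cone_exit klT' vk vl sx' abk' vax bvx abx0 (or_intror (conj al' bl')).
  exact: (cone_empty (And3 i1 abk' i2)).
have : 0 < o a b k \/ 0 < o a b l.
  case: (ltrP 0 (o a b k)) => [|le1]; first by left.
  case: (ltrP 0 (o a b l)) => [|le2]; first by right.
  have ltk : o a b k < 0 by rewrite lt_neqAle abk0.
  have ltl : o a b l < 0 by rewrite lt_neqAle abl0.
  by case: sx abx => t [t01 ->]; rewrite orient_lerp; nra.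
case=> lt; first exact: (key k l).
by apply: (key l k) => //; [rewrite setUC | apply: segmentC].
Qed.

End Cone.

(** A three-term Grassmann-Pluecker relation between the directions from v to a, b, w and u. *)
Lemma cone_trans v a b w u : 0 < o v a b -> 0 < o v a w -> 0 < o b v w ->
  0 < o v a u -> 0 < o w v u -> 0 < o b v u.
Proof.
move=> D aw bw au wu.
have E : o v a w * o b v u = o v a u * o b v w + o v a b * o w v u.
  by rewrite /orient; ring.
by rewrite -(pmulr_rgt0 _ aw) E addr_gt0 ?mulr_gt0.
Qed.

Lemma cone_trans' v a b w u : 0 < o v a b -> 0 < o v a w -> 0 < o b v w ->
  0 < o v w u -> 0 < o b v u -> 0 < o v a u.
Proof.
move=> D aw bw wu bu.
have E : o b v w * o v a u = o b v u * o v a w + o v a b * o v w u.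
  by rewrite /orient; ring.
by rewrite -(pmulr_rgt0 _ bw) E addr_gt0 ?mulr_gt0.
Qed.

Definition cone_nbrs T v a b := [set w | [&& [set v; w] \in T, 0 < o v a w & 0 < o b v w]].

Lemma card_cone_nbrs_l T v a b w : 0 < o v a b -> w \in cone_nbrs T v a b ->
  (#|cone_nbrs T v a w| < #|cone_nbrs T v a b|)%N.
Proof.
move=> D wC; move: (wC); rewrite inE => /and3P[vwT aw bw].
apply/proper_card/properP; split.
  apply/subsetP=> u; rewrite !inE => /and3P[-> au wu]; rewrite au /=.
  exact: cone_trans D aw bw au wu.
by exists w => //; rewrite inE orient_xx ltxx !andbF.
Qed.

Lemma card_cone_nbrs_r T v a b w : 0 < o v a b -> w \in cone_nbrs T v a b ->
  (#|cone_nbrs T v w b| < #|cone_nbrs T v a b|)%N.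
Proof.
move=> D wC; move: (wC); rewrite inE => /and3P[vwT aw bw].
apply/proper_card/properP; split.
  apply/subsetP=> u; rewrite !inE => /and3P[-> wu bu]; rewrite bu andbT /=.
  exact: cone_trans' D aw bw wu bu.
by exists w => //; rewrite inE orient_xx ltxx !andbF.
Qed.

(** Induction on the number of neighbours of v in the angle avb. If there is none, ab is an edge and
    closure under triangles carries membership both ways; otherwise a neighbour w splits the
    angle. *)
Lemma star_connected T (B : {set 'I_n}) v a b : triangulation p T ->
  (forall v a b, v \in B -> a \in B -> [set v; a] \in T -> [set v; b] \in T ->
    [set a; b] \in T -> b \in B) ->
  v \in B -> a \in B -> [set v; a] \in T -> [set v; b] \in T -> b \in B.
Proof.
move=> triT clB vB.
have key k : forall a b, (#|cone_nbrs T v a b| <= k)%N -> 0 < o v a b ->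
    [set v; a] \in T -> [set v; b] \in T -> (a \in B) = (b \in B).
  elim: k => [|k IH] a' b' ck D aT bT.
    have abT : [set a'; b'] \in T.
      apply: (cone_closing_edge triT D) => // w wT aw bw.
      move: ck; rewrite leqn0 cards_eq0 => /eqP/setP/(_ w).
      by rewrite !inE wT aw bw.
    apply/idP/idP=> h; first exact: (clB v a' b').
    by apply: (clB v b' a') => //; rewrite setUC.
  case: (set_0Vmem (cone_nbrs T v a' b')) => [E|[w wC]].
    by apply: IH => //; rewrite E cards0.
  move: (wC); rewrite inE => /and3P[vwT aw bw].
  have wb : 0 < o v w b' by rewrite orient_rot orient_rot.
  transitivity (w \in B); apply: IH => //; rewrite -ltnS; apply: leq_trans ck.
    exact: card_cone_nbrs_l.
  exact: card_cone_nbrs_r.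
move=> aB aT bT.
have [sT _ _] := triT.
case: (eqVneq a b) => [<- //|ab].
have va := edge_neq sT aT; have vb := edge_neq sT bT.
(* In one of the two orders of a and b the angle at v is less than pi, so hull vertices are treated
   like inner ones. *)
have := gp va ab vb; rewrite neq_lt => /orP[lt|gt]; last by rewrite -(key _ a b (leqnn _)).
rewrite (key _ b a (leqnn _)) //.
by rewrite orient_rot orient_swap oppr_gt0 orient_rot orient_rot.
Qed.

End Triangulations.

(** * Faces *)

Section Faces.
Variables (R : realType) (n : nat) (p : 'I_n -> 'rV[R]_2).
Hypothesis gp : general_position p.
Variable T : edges n.
Hypothesis triT : triangulation p T.

Local Notation o i j k := (orient (p i) (p j) (p k)).

(** * The first edge yz of T crossed by the segment am *)

Section FirstCrossing.
Implicit Types (q r u : 'rV[R]_2) (t : R).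
Variables (a m y z : 'I_n) (s : R).
Hypotheses (am : a != m) (yzT : [set y; z] \in T).
Hypothesis dis : [disjoint [set a; m] & [set y; z]].
Hypothesis s01 : 0 <= s <= 1.
Let x := (1 - s) *: p a + s *: p m.
Hypothesis sx : segment (p y) (p z) x.
Hypothesis first : forall g h t, [set g; h] \in T -> [disjoint [set a; m] & [set g; h]] ->
  0 <= t <= 1 -> segment (p g) (p h) ((1 - t) *: p a + t *: p m) -> s <= t.

Let K := o a m y.
(* Coordinates in the affine frame a, m, y. *)
Let al q := orient (p a) q (p y) / K.
Let be q := orient (p a) (p m) q / K.
(** Zero on the line yz, which in this frame passes through y = (0, 1) and x = (s, 0), and equal to
    s at a. *)
Let lam q := s - al q - s * be q.

Let K0 : K != 0.
Proof.
have [sT _ _] := triT; have yz := edge_neq sT yzT.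
by move: dis; rewrite disjoint_set2 => /and4P[ay az my mz]; apply: gp.
Qed.

Let al_lerp q r t : al ((1 - t) *: q + t *: r) = (1 - t) * al q + t * al r.
Proof. by rewrite /al /orient !mxE; field. Qed.

Let be_lerp q r t : be ((1 - t) *: q + t *: r) = (1 - t) * be q + t * be r.
Proof. by rewrite /be orient_lerp; field. Qed.

Let lam_lerp q r t : lam ((1 - t) *: q + t *: r) = (1 - t) * lam q + t * lam r.
Proof. by rewrite /lam al_lerp be_lerp; ring. Qed.

Let al_a : al (p a) = 0. Proof. by rewrite /al orient_xx mul0r. Qed.
Let al_m : al (p m) = 1. Proof. by rewrite /al divff. Qed.
Let al_y : al (p y) = 0. Proof. by rewrite /al orient_xx mul0r. Qed.
Let be_a : be (p a) = 0. Proof. by rewrite /be orient_xx mul0r. Qed.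
Let be_m : be (p m) = 0. Proof. by rewrite /be orient_xx mul0r. Qed.
Let be_y : be (p y) = 1. Proof. by rewrite /be divff. Qed.

Let alK q : al q * K = orient (p a) q (p y). Proof. exact: divfK. Qed.
Let beK q : be q * K = orient (p a) (p m) q. Proof. exact: divfK. Qed.

Let frame u q : orient (p a) u q = al q * orient (p a) u (p m) + be q * orient (p a) u (p y).
Proof.
apply: (mulIf K0); transitivity (al q * K * orient (p a) u (p m) + be q * K * orient (p a) u (p y)).
  by rewrite alK beK /K /orient; ring.
by ring.
Qed.

Let coordE q r : al q = al r -> be q = be r -> q = r.
Proof.
have E (w : 'rV[R]_2) (k : 'I_2) : w 0 k = p a 0 k + al w * (p m 0 k - p a 0 k) + be w * (p y 0 k - p a 0 k).
  apply: (mulIf K0).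
  transitivity (p a 0 k * K + al w * K * (p m 0 k - p a 0 k) + be w * K * (p y 0 k - p a 0 k)); last by ring.
  rewrite alK beK; case: (eqVneq k 0) => [->|k0]; first by rewrite /K /orient; ring.
  have -> : k = 1 by apply/val_inj; case: k k0 => [[|[|]]].
  by rewrite /K /orient; ring.
by move=> e1 e2; apply/rowP=> k; rewrite (E q) (E r) e1 e2.
Qed.

Let facts : [/\ 0 < s, s < 1, lam (p z) = 0 & be (p z) < 0].
Proof.
have [sT _ _] := triT; have yz := edge_neq sT yzT.
move: dis; rewrite disjoint_set2 => /and4P[ay az my mz].
have s0 : 0 < s.
  rewrite lt_neqAle (andP s01).1 andbT; apply: contraTneq isT => s0.
  move: sx; rewrite /x -s0 subr0 scale1r scale0r addr0.
  by case/(vertex_on_segment gp yz) => E; move: ay az; rewrite E eqxx.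
have s1 : s < 1.
  rewrite lt_neqAle (andP s01).2 andbT; apply: contraTneq isT => s1.
  move: sx; rewrite /x s1 subrr scale1r scale0r add0r.
  by case/(vertex_on_segment gp yz) => E; move: my mz; rewrite E eqxx.
have bex : be x = 0 by rewrite be_lerp be_a be_m; ring.
have lamx : lam x = 0 by rewrite lam_lerp /lam al_a al_m be_a be_m; ring.
have xz : x != p z.
  apply/eqP=> xz; have : segment (p a) (p m) (p z) by rewrite -xz; exists s.
  by case/(vertex_on_segment gp am) => E; move: az mz; rewrite E eqxx.
case: sx bex lamx xz => t [t01 ->]; rewrite be_lerp lam_lerp be_y /lam al_y be_y => bex lamx xz.
have t1 : t < 1.
  rewrite lt_neqAle (andP t01).2 andbT; apply: contraNneq xz => ->.
  by rewrite subrr scale0r scale1r add0r.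
have t0 : 0 < t by rewrite lt_neqAle (andP t01).1 andbT; apply/eqP=> t0E; rewrite -t0E in bex; lra.
split=> //; last by nra.
by apply: (mulfI (lt0r_neq0 t0)); move: lamx; rewrite /lam; lra.
Qed.

(** The candidates for c fill the triangle a, x, y without its side ax, and c is one whose direction
    from a is closest to am. The endpoint g lies beyond ac on the side of m, hence is no candidate.
    So the way from the crossing point to g leaves the triangle through am before x, against
    [first], or through yz, against non-crossing. *)
Let no_crossing c (r : R) g h :
  c != a -> 0 <= al (p c) -> 0 < be (p c) -> 0 <= lam (p c) ->
  (forall w, w != a -> 0 <= al (p w) -> 0 < be (p w) -> 0 <= lam (p w) ->
    al (p w) / be (p w) <= al (p c) / be (p c)) ->
  [set g; h] \in T -> a != g -> a != h -> c != g -> c != h ->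
  0 < r <= 1 -> segment (p g) (p h) ((1 - r) *: p a + r *: p c) ->
  0 < al (p g) * be (p c) - be (p g) * al (p c) -> False.
Proof.
move=> ca alc bec lamc maxc ghT ag ah cg ch r01 sx' psig.
have [sT nc _] := triT; have gh := edge_neq sT ghT; have yz := edge_neq sT yzT.
have [s0 s1 lamz bez] := facts.
move: (dis); rewrite disjoint_set2 => /and4P[ay az my mz].
set x' := _ + _ in sx'.
have bex' : be x' = r * be (p c) by rewrite be_lerp be_a; ring.
have alx' : al x' = r * al (p c) by rewrite al_lerp al_a; ring.
have lamx' : 0 <= lam x' by move: lamc; rewrite /lam bex' alx'; nra.
have bex'0 : 0 < be x' by rewrite bex' mulr_gt0 // (andP r01).1.
have out : [\/ be (p g) < 0, lam (p g) < 0 | (0 : R) < 0].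
  case: (ltrP (be (p g)) 0) => [|beg]; first by constructor 1.
  constructor 2; case: (eqVneq (be (p g)) 0) => [beg0|begN0].
    have gE : g = m.
      apply/eqP/negPn/negP=> gm; have := @gp a m g am; rewrite eq_sym => /(_ gm ag).
      by move/eqP: beg0; rewrite /be mulf_eq0 invr_eq0 (negPf K0) orbF => ->.
    by rewrite gE /lam al_m be_m; lra.
  have beg_gt0 : 0 < be (p g) by rewrite lt_neqAle eq_sym begN0.
  have alg : 0 <= al (p g) by nra.
  rewrite ltNge; apply/negP=> lamg; have := maxc g; rewrite eq_sym => /(_ ag alg beg_gt0 lamg).
  by rewrite ler_pdivrMr // mulrAC ler_pdivlMr //; lra.
(* Only [be] and [lam] can turn negative; the third function given to [exit3] is constantly 0. *)
have [t [t01 [f1 f2 _] zero]] := exit3 (ltW bex'0) lamx' (lexx 0) out.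
move: f1 f2 zero; rewrite -be_lerp -lam_lerp; set q := _ + _ => beq lamq zero.
have sq : segment (p g) (p h) q by apply: segment_trans sx' _; exists t.
have psiq : 0 <= al q * be (p c) - be q * al (p c).
  rewrite al_lerp be_lerp alx' bex'.
  have -> : ((1 - t) * (r * al (p c)) + t * al (p g)) * be (p c) -
    ((1 - t) * (r * be (p c)) + t * be (p g)) * al (p c) =
    t * (al (p g) * be (p c) - be (p g) * al (p c)) by ring.
  by apply: mulr_ge0 (ltW psig); case/andP: t01.
have on_yz : lam q = 0 -> False.
  move=> lamq0.
  have alq : al q = s * (1 - be q) by move: lamq0; rewrite /lam; lra.
  have beq1 : be q <= 1.
    rewrite leNgt; apply/negP=> beq1.
    have alq0 : al q < 0 by rewrite alq; nra.
    by nra.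
  have sqyz : segment (p y) (p z) q.
    apply: segment_trans sx _; exists (be q); split; first by rewrite beq.
    apply: coordE; first by rewrite al_lerp al_y alq /x al_lerp al_a al_m; ring.
    by rewrite be_lerp be_y /x be_lerp be_a be_m; ring.
  case: (edges_meet gp sT nc ghT yzT sq sqyz) => [/set2_eq[] [gE hE]|[u [ugh uyz qE]]].
  - by move: psig; rewrite gE al_y be_y; lra.
  - have : lam x' = 0.
      case: sx' => t' [t'01 ->]; rewrite lam_lerp gE hE lamz /lam al_y be_y; ring.
    rewrite /lam alx' bex' => lamx'0.
    have r1 : r = 1 by move: lamc; rewrite /lam; nra.
    move: sx'; rewrite /x' r1 subrr scale0r add0r scale1r.
    by case/(vertex_on_segment gp gh) => E; move: cg ch; rewrite E eqxx.
  - case: uyz => E; last by move: beq; rewrite qE E; lra.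
    have alc0 : al (p c) = 0 by move: psiq; rewrite qE E al_y be_y; lra.
    have cE : c = y.
      apply/eqP/negPn/negP=> cy; have := @gp a c y; rewrite eq_sym => /(_ ca cy ay).
      by move/eqP: alc0; rewrite /al mulf_eq0 invr_eq0 (negPf K0) orbF => ->.
    by move: cg ch; case: ugh => E'; rewrite cE -E E' eqxx.
case: zero => -[E neg]; last by rewrite ltxx in neg.
  have alq0 : 0 <= al q by move: psiq; rewrite E mul0r subr0 pmulr_lge0.
  have alqs : al q <= s by move: lamq; rewrite /lam E; lra.
  case: (eqVneq (al q) s) => [alqE|alqN]; first by apply: on_yz; rewrite /lam E alqE; ring.
  have mg : m != g by apply: contraTneq neg => <-; rewrite be_m ltxx.
  have mh : m != h.
    apply/eqP=> mh; move: bex'0; case: sx' => t' [t'01 ->].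
    by rewrite be_lerp -mh be_m; nra.
  have : s <= al q.
    apply: (first ghT).
    - by rewrite disjoint_set2 ag ah mg mh.
    - lra.
    - have <- // : q = (1 - al q) *: p a + al q *: p m.
      apply: coordE; first by rewrite [RHS]al_lerp al_a al_m; ring.
      by rewrite [RHS]be_lerp be_a be_m E; ring.
  by rewrite leNgt lt_neqAle alqN alqs.
exact: on_yz.
Qed.

(** The condition on u holds because c - a is a combination of m - a and y - a with nonnegative
    coefficients, the second one positive. *)
Lemma first_crossing_nbr : exists2 c, [set a; c] \in T &
  forall u, 0 < orient (p a) u (p m) -> 0 < orient (p a) u (p y) -> 0 < orient (p a) u (p c).
Proof.
have [sT nc _] := triT.
have [s0 s1 lamz bez] := facts.
move: (dis); rewrite disjoint_set2 => /and4P[ay az my mz].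
have y_cand : [/\ y != a, 0 <= al (p y), 0 < be (p y) & 0 <= lam (p y)].
  rewrite eq_sym ay /lam al_y be_y; split=> //; lra.
have [c [[ca alc bec lamc] maxc]] := @ex_max R _
  (fun c => [/\ c != a, 0 <= al (p c), 0 < be (p c) & 0 <= lam (p c)])
  (fun c => al (p c) / be (p c)) y y_cand.
exists c; last by move=> u um uy; rewrite frame; nra.
apply/negPn/negP=> acT.
have ac : a != c by rewrite eq_sym.
have [g [h [q [ghT]]]] := triangulation_crossed triT ac acT.
rewrite disjoint_set2 => /and4P[ag ah cg ch] [r [r01 qE]] sq.
have gh := edge_neq sT ghT.
have r0 : 0 < r <= 1.
  rewrite (andP r01).2 andbT lt_neqAle (andP r01).1 andbT; apply: contraTneq isT => r0.
  move: sq; rewrite qE -r0 subr0 scale1r scale0r addr0.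
  by case/(vertex_on_segment gp gh) => E; move: ag ah; rewrite E eqxx.
rewrite qE in sq.
have maxc' w : w != a -> 0 <= al (p w) -> 0 < be (p w) -> 0 <= lam (p w) ->
    al (p w) / be (p w) <= al (p c) / be (p c).
  by move=> *; apply: maxc.
have K_psi w : o a w c = K * (al (p w) * be (p c) - be (p w) * al (p c)).
  rewrite (frame (p w) (p c)) -alK; have -> : o a w m = - (be (p w) * K); last by ring.
  by rewrite beK /orient; ring.
have psiN0 w : a != w -> c != w -> al (p w) * be (p c) - be (p w) * al (p c) != 0.
  move=> aw cw; have := @gp a w c aw; rewrite (eq_sym w) K_psi => /(_ cw ac).
  by apply: contraNneq => ->; rewrite mulr0.
case: (ltrP 0 (al (p g) * be (p c) - be (p g) * al (p c))) => psi_g.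
  exact: (no_crossing ca alc bec lamc maxc' ghT ag ah cg ch r0 sq psi_g).
have psi_h : 0 < al (p h) * be (p c) - be (p h) * al (p c).
  rewrite ltNge; apply/negP=> psi_h.
  have alq := al_lerp (p a) (p c) r; have beq := be_lerp (p a) (p c) r.
  move: alq beq; case: (sq) => t [t01 ->]; rewrite al_lerp be_lerp al_a be_a => alq beq.
  have psi0 : (1 - t) * (al (p g) * be (p c) - be (p g) * al (p c)) +
              t * (al (p h) * be (p c) - be (p h) * al (p c)) = 0.
    transitivity (((1 - t) * al (p g) + t * al (p h)) * be (p c) -
                  ((1 - t) * be (p g) + t * be (p h)) * al (p c)); first by ring.
    by rewrite alq beq; ring.
  have ltg : al (p g) * be (p c) - be (p g) * al (p c) < 0 by rewrite lt_neqAle psiN0.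
  have lth : al (p h) * be (p c) - be (p h) * al (p c) < 0 by rewrite lt_neqAle psiN0.
  move: ltg lth psi0; set A := _ - _; set B := al (p h) * _ - _; clearbody A B => ltA ltB psi0.
  by nra.
have hgT : [set h; g] \in T by rewrite setUC.
exact: (no_crossing ca alc bec lamc maxc' hgT ah ag ch cg r0 (segmentC sq) psi_h).
Qed.

End FirstCrossing.

(** If am is not an edge, the first edge that it crosses has an endpoint to the left of ab, since
    the crossing point is there; that endpoint plays the role of y in [first_crossing_nbr]. *)
Lemma nbr_on_side a b m : a != b -> 0 < o a b m ->
  exists2 c, [set a; c] \in T & 0 < o a b c.
Proof.
move=> ab abm; have [sT nc _] := triT.
have am : a != m by apply: contraTneq abm => <-; rewrite orient_xx ltxx.
case: (boolP ([set a; m] \in T)) => amT; first by exists m.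
have [y0 [z0 [x0 [yzT0 dis0 [s0 [s001 x0E]] sx0]]]] := triangulation_crossed triT am amT.
pose crossed (e : 'I_n * 'I_n) s := [/\ [set e.1; e.2] \in T,
  [disjoint [set a; m] & [set e.1; e.2]], 0 <= s <= 1 &
  segment (p e.1) (p e.2) ((1 - s) *: p a + s *: p m)].
(* The parameter on am of the crossing with the line through e. It is determined by e, so a first
   crossing exists as a minimum over a finite type. *)
pose f (e : 'I_n * 'I_n) := o e.1 e.2 a / (o e.1 e.2 a - o e.1 e.2 m).
have paramE e s : crossed e s -> s = f e.
  case: e => y z [/= yzT dis s01 /segment_orient]; rewrite orient_lerp => E.
  have yz := edge_neq sT yzT; move: dis; rewrite disjoint_set2 => /and4P[ay az my mz].
  have yza : o y z a != 0 by apply: gp; rewrite // eq_sym.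
  have d0 : o y z a - o y z m != 0.
    apply: contraNneq yza => /eqP; rewrite subr_eq0 => /eqP E2; move: E; rewrite -E2 => <-.
    by apply/eqP; ring.
  apply: (mulIf d0); rewrite /f /= divfK //; lra.
have ex0 : exists s, crossed (y0, z0) s by exists s0; split=> //=; rewrite -x0E.
have [[y z] [[s cs] mins]] := @ex_min R _ (fun e => exists s, crossed e s) f _ ex0.
have [/= yzT dis s01 sx] := cs.
have first g h t : [set g; h] \in T -> [disjoint [set a; m] & [set g; h]] ->
    0 <= t <= 1 -> segment (p g) (p h) ((1 - t) *: p a + t *: p m) -> s <= t.
  move=> ghT dgh t01 st; have ct : crossed (g, h) t by split.
  by rewrite (paramE _ _ cs) (paramE _ _ ct); apply: mins; exists t.
have yz := edge_neq sT yzT.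
have s_gt0 : 0 < s.
  rewrite lt_neqAle (andP s01).1 andbT; apply: contraTneq isT => s0E.
  move: sx dis; rewrite -s0E subr0 scale1r scale0r addr0 disjoint_set2 => sx /and4P[ay az _ _].
  by case/(vertex_on_segment gp yz): sx => E; move: ay az; rewrite E eqxx.
have : 0 < o a b y \/ 0 < o a b z.
  case: (ltrP 0 (o a b y)) => [|le1]; first by left.
  case: (ltrP 0 (o a b z)) => [|le2]; first by right.
  have : 0 < orient (p a) (p b) ((1 - s) *: p a + s *: p m) by rewrite orient_lerp orient_xx; nra.
  by case: sx => t [t01 ->]; rewrite orient_lerp; nra.
case=> lt.
  have [c acT pos] := first_crossing_nbr am yzT dis s01 sx first.
  by exists c => //; apply: pos.
have zyT : [set z; y] \in T by rewrite setUC.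
have dis' : [disjoint [set a; m] & [set z; y]] by rewrite (setUC [set z]).
have [c acT pos] := first_crossing_nbr am zyT dis' s01 (segmentC sx) first.
by exists c => //; apply: pos.
Qed.

End Faces.

(** The vertices are counterclockwise, so abc is the face to the left of ab, and the face across ab
    is written bad. *)
Definition face (R : realType) n (p : 'I_n -> 'rV[R]_2) (T : edges n) a b c :=
  [/\ 0 < orient (p a) (p b) (p c), [set a; b] \in T, [set b; c] \in T, [set c; a] \in T &
      empty_triangle p a b c].

Section Apex.
Variables (R : realType) (n : nat) (p : 'I_n -> 'rV[R]_2).
Hypothesis gp : general_position p.
Variable T : edges n.
Local Notation o i j k := (orient (p i) (p j) (p k)).

Lemma face_rot a b c : face p T a b c -> face p T b c a.
Proof.
case=> D abT bcT caT em; split=> //; first by rewrite -orient_rot.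
by move=> w [h1 h2 h3]; apply: (em w).
Qed.

(** The apex c is a neighbour of a left of ab with the fewest neighbours of a in the angle from ab
    to ac. A neighbour in that angle would have fewer, so there is none and the results on cones
    apply. *)
Lemma face_exists a b m : triangulation p T -> [set a; b] \in T -> 0 < o a b m ->
  exists c, face p T a b c.
Proof.
move=> triT abT abm; have [sT nc _] := triT.
have ab := edge_neq sT abT.
have [c0 acT0 abc0] := nbr_on_side gp triT ab abm.
pose nbr c := ([set a; c] \in T) && (0 < o a b c).
have nbr0 : nbr c0 by apply/andP.
case: (@arg_minnP _ c0 nbr (fun c => #|cone_nbrs p T a b c|) nbr0) => c /andP[acT abc] minc.
have no_nbr w : [set a; w] \in T -> 0 < o a b w -> 0 < o c a w -> False.
  move=> awT abw caw; have wC : w \in cone_nbrs p T a b c by rewrite inE awT abw.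
  have := minc w; rewrite /nbr awT abw => /(_ isT).
  by rewrite leqNgt (card_cone_nbrs_l abc wC).
exists c; split=> //.
- exact: (cone_closing_edge gp triT abc abT acT no_nbr).
- by rewrite setUC.
- exact: (cone_empty gp triT abc abT acT no_nbr).
Qed.

End Apex.

(** * Flips *)

Section Lifting.
Variable R : realType.
Implicit Types (a b c d i j : 'rV[R]_2) (s : R).

Definition lift_height a : R := a 0 0 ^+ 2 + a 0 1 ^+ 2.

(* For abc counterclockwise: negative, zero or positive according as d lies
   inside, on or outside the circle abc, i.e. the lift of d to the paraboloid
   lies below, on or above the plane through the lifts of a, b, c. *)
Definition incircle a b c d : R :=
  orient a b c * lift_height d -
  (orient b c d * lift_height a + orient c a d * lift_height b + orient a b d * lift_height c).

Lemma incircle_rot a b c d : incircle a b c d = incircle b c a d.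
Proof. rewrite /incircle /orient; ring. Qed.

Lemma incircle_xx a b c :
  (incircle a b c a = 0) * (incircle a b c b = 0) * (incircle a b c c = 0).
Proof. by do !split; rewrite /incircle /orient; ring. Qed.

(** The determinant is invariant under translation; with b as the origin all heights are
    nonnegative, as [convex_sign] requires. *)
Lemma incircle_dist a b c d : incircle a b c d =
  orient a b c * ((d 0 0 - b 0 0) ^+ 2 + (d 0 1 - b 0 1) ^+ 2) -
  orient b c d * ((a 0 0 - b 0 0) ^+ 2 + (a 0 1 - b 0 1) ^+ 2) -
  orient a b d * ((c 0 0 - b 0 0) ^+ 2 + (c 0 1 - b 0 1) ^+ 2).
Proof. rewrite /incircle /lift_height /orient; ring. Qed.

Lemma convex_sign (D A B P Q S : R) : 0 < D -> A < 0 -> 0 <= P -> 0 <= Q -> 0 <= S ->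
  D * P - B * Q - A * S < 0 -> 0 < B.
Proof.
move=> D0 A0 P0 Q0 S0 neg; rewrite ltNge; apply/negP=> B0.
have : 0 <= D * P by rewrite mulr_ge0 ?(ltW D0).
have : B * Q <= 0 by rewrite mulr_le0_ge0.
have : A * S <= 0 by rewrite mulr_le0_ge0 ?(ltW A0).
lra.
Qed.

(** With its mirror image at a, this makes the two faces at an illegal edge a convex quadrilateral,
    so that the edge can be flipped. *)
Lemma incircle_convex a b c d : 0 < orient a b c -> orient a b d < 0 ->
  incircle a b c d < 0 -> 0 < orient b c d.
Proof.
by move=> D abd; rewrite incircle_dist; apply: convex_sign; rewrite ?addr_ge0 ?sqr_ge0.
Qed.

Lemma incircle_lerp a b c i j s :
  (1 - s) * incircle a b c i + s * incircle a b c j =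
  orient a b c * ((1 - s) * lift_height i + s * lift_height j) -
  (orient b c ((1 - s) *: i + s *: j) * lift_height a +
   orient c a ((1 - s) *: i + s *: j) * lift_height b +
   orient a b ((1 - s) *: i + s *: j) * lift_height c).
Proof. rewrite !orient_lerp /incircle; ring. Qed.

(** Up to the factor [orient a b c], [incircle] is the height above the plane through the lifts of
    a, b, c; over the common point of the two chords this plane has a single height, which
    cancels. *)
Lemma lower_incircle a b c i j k l s t : 0 < orient a b c ->
  (1 - s) *: i + s *: j = (1 - t) *: k + t *: l ->
  ((1 - t) * lift_height k + t * lift_height l < (1 - s) * lift_height i + s * lift_height j) =
  ((1 - t) * incircle a b c k + t * incircle a b c l <
   (1 - s) * incircle a b c i + s * incircle a b c j).
Proof.
move=> D E; rewrite !incircle_lerp E; set W := (_ + _ + _).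
by rewrite ltrD2r ltr_pM2l.
Qed.

End Lifting.

Section AffineParameters.
Variable R : realType.
Implicit Types f g s t u : R.

Lemma param_towards_0 s u : 0 <= s <= 1 -> 0 <= u <= 1 -> 0 <= s * (1 - u) <= s.
Proof. by nra. Qed.

Lemma param_towards_1 s u : 0 <= s <= 1 -> 0 <= u <= 1 -> s <= s + u * (1 - s) <= 1.
Proof. by nra. Qed.

Lemma affine_beyond f g s1 s s2 : s1 <= s -> s <= s2 -> (1 - s1) * f + s1 * g <= 0 ->
  0 < (1 - s) * f + s * g -> 0 < (1 - s2) * f + s2 * g.
Proof.
move=> s1s ss2 le pos; have pr : 0 < (s - s1) * (g - f) by lra.
have d0 : 0 < g - f by nra.
by nra.
Qed.

Lemma lerp_le0 f g s : 0 <= s <= 1 -> f <= 0 -> g <= 0 -> (1 - s) * f + s * g <= 0.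
Proof. by nra. Qed.

Lemma lerp_lt0 f g s : 0 <= s <= 1 -> f < 0 -> g < 0 -> (1 - s) * f + s * g < 0.
Proof. by nra. Qed.

Lemma lerp_gt0 f g s : 0 <= s <= 1 -> 0 < f -> 0 < g -> 0 < (1 - s) * f + s * g.
Proof. by nra. Qed.

End AffineParameters.

Section Flip.
Variables (R : realType) (n : nat) (p : 'I_n -> 'rV[R]_2).
Hypothesis gp : general_position p.
Implicit Type T : edges n.

Local Notation o i j k := (orient (p i) (p j) (p k)).
Local Notation h i := (lift_height (p i)).
Local Notation inc a b c d := (incircle (p a) (p b) (p c) (p d)).

(** Followed from q towards an endpoint other than a and b, the edge leaves the empty face through a
    side, which it can meet only in a corner that is its other endpoint; then q could not be
    strictly inside that side. So both endpoints are among a and b. *)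
Lemma face_crossing T a b c g k q : T \subset complete_graph n -> noncrossing p T ->
  face p T a b c -> [set g; k] \in T -> c != g -> c != k -> [set g; k] != [set a; b] ->
  segment (p g) (p k) q -> 0 <= orient (p a) (p b) q ->
  0 < orient (p b) (p c) q -> 0 < orient (p c) (p a) q -> False.
Proof.
move=> sT nc [D abT bcT caT em] gkT cg ck gkN sq abq bcq caq.
have ab := edge_neq sT abT; have bc := edge_neq sT bcT; have ca := edge_neq sT caT.
have gk := edge_neq sT gkT.
have notin u : u = a \/ u = b -> q <> p u.
  by case=> -> E; move: bcq caq; rewrite E !orient_xx ltxx.
have abq0 : 0 < orient (p a) (p b) q.
  rewrite lt_neqAle abq andbT; apply/eqP=> abq0.
  have sab : segment (p a) (p b) q by apply: (triangle_side D); rewrite ?ltW // abq0.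
  case: (edges_meet gp sT nc gkT abT sq sab) => [E|[u [_ uab E]]]; last exact: notin uab E.
  by rewrite E eqxx in gkN.
have key g' k' : [set g'; k'] \in T -> c != g' -> c != k' -> segment (p g') (p k') q ->
    g' = a \/ g' = b.
  move=> gkT' cg' ck' sq'.
  case: (eqVneq g' a) => [|ga]; first by left.
  case: (eqVneq g' b) => [|gb]; [by right | exfalso].
  have [ag bg] : a != g' /\ b != g' by rewrite (eq_sym a) (eq_sym b).
  have abg : o a b g' != 0 by apply: gp.
  have bcg : o b c g' != 0 by apply: gp.
  have cag : o c a g' != 0 by apply: gp.
  have neg : [\/ o a b g' < 0, o b c g' < 0 | o c a g' < 0].
    case: (ltrP (o a b g') 0) => [|le1]; first by constructor 1.
    case: (ltrP (o b c g') 0) => [|le2]; first by constructor 2.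
    case: (ltrP (o c a g') 0) => [|le3]; first by constructor 3.
    case: (em g'); rewrite !lt_neqAle le1 le2 le3.
    by rewrite !(eq_sym 0) abg bcg cag.
  have [t [t01]] := triangle_exit D abq (ltW bcq) (ltW caq) neg.
  set r := _ + _ => side.
  have sr : segment (p g') (p k') r by apply: segment_trans sq' _; exists t.
  have bad u w : [set u; w] \in T -> u != g' -> w != g' -> segment (p u) (p w) r ->
      orient (p u) (p w) (p g') < 0 -> 0 < orient (p u) (p w) q -> False.
    move=> uwT ug wg suw neg' pos.
    case: (edges_meet gp sT nc gkT' uwT sr suw) => [/set2_eq|[v [vgk vuw E]]].
      by case=> -[E _]; move: ug wg; rewrite E eqxx.
    have vk : v = k' by case: vgk => // vE; move: ug wg; case: vuw => <-; rewrite vE eqxx.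
    have uwk : o u w k' = 0 by rewrite -vk; case: vuw => ->; rewrite orient_xx.
    move: pos; case: sq' => t' [t'01 ->]; rewrite orient_lerp uwk; nra.
  case: side => -[suw neg'].
  - exact: (bad a b).
  - exact: (bad b c).
  - exact: (bad c a).
case: (key g k gkT cg ck sq) => gE.
all: case: (key k g _ ck cg (segmentC sq)) => [|kE|kE]; first by rewrite setUC.
all: by move: gk gkN; rewrite gE kE ?eqxx // setUC eqxx.
Qed.

Definition dead T i j := exists k l s t,
  [/\ [set k; l] \in T, [disjoint [set i; j] & [set k; l]], (0 <= s <= 1) && (0 <= t <= 1),
      (1 - s) *: p i + s *: p j = (1 - t) *: p k + t *: p l &
      (1 - t) * h k + t * h l < (1 - s) * h i + s * h j].

Lemma deadC T i j : dead T i j -> dead T j i.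
Proof.
case=> k [l [s [t [klT dis s01 E lt]]]]; exists k, l, (1 - s), t; split=> //.
- by rewrite (setUC [set j]).
- lra.
- by rewrite -E addrC; congr (_ *: _ + _ *: _); ring.
- lra.
Qed.

Lemma dead_notin T i j : noncrossing p T -> dead T i j -> [set i; j] \notin T.
Proof.
move=> nc [k [l [s [t [klT dis /andP[s01 t01] E _]]]]]; apply/negP=> ijT.
apply: (nc _ _ _ _ ijT klT dis); exists ((1 - s) *: p i + s *: p j); split; first by exists s.
by exists t.
Qed.

Section IllegalEdge.
Variables (T : edges n) (a b c d : 'I_n).
Hypotheses (triT : triangulation p T) (fc : face p T a b c) (fd : face p T b a d).
Hypothesis illegal : inc a b c d < 0.

Let abd : o a b d < 0.
Proof. by case: fd => D _ _ _ _; rewrite orient_swap oppr_gt0 in D. Qed.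

Let bcd : 0 < o b c d.
Proof. by case: fc => D _ _ _ _; apply: incircle_convex illegal. Qed.

Let cad : 0 < o c a d.
Proof.
case: fc => D _ _ _ _.
(* The argument of [incircle_convex] with a as the origin. *)
apply: (@convex_sign _ (o a b c) (o a b d) _ ((p d 0 0 - p a 0 0) ^+ 2 + (p d 0 1 - p a 0 1) ^+ 2)
  ((p b 0 0 - p a 0 0) ^+ 2 + (p b 0 1 - p a 0 1) ^+ 2)
  ((p c 0 0 - p a 0 0) ^+ 2 + (p c 0 1 - p a 0 1) ^+ 2)); rewrite ?addr_ge0 ?sqr_ge0 //.
by move: illegal; congr (_ < _); rewrite /incircle /lift_height /orient; ring.
Qed.

Let diagonal : exists t s, [/\ 0 < t <= 1, 0 <= s <= 1 &
  (1 - t) *: p c + t *: p d = (1 - s) *: p a + s *: p b].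
Proof.
case: fc => D _ _ _ _.
have d0 : 0 < o a b c - o a b d by rewrite subr_gt0; apply: lt_trans D.
pose t := o a b c / (o a b c - o a b d).
have t0 : 0 < t by rewrite divr_gt0.
have t1 : t <= 1 by rewrite ler_pdivrMr // mul1r; move: abd; lra.
have [|||s [s01 E]] := @triangle_side _ (p a) (p b) (p c) ((1 - t) *: p c + t *: p d) D.
- by rewrite orient_lerp /t; field; rewrite lt0r_neq0.
- by rewrite orient_lerp orient_xx mulr0 add0r mulr_ge0 ?(ltW bcd) ?(ltW t0).
- by rewrite orient_lerp orient_xx mulr0 add0r mulr_ge0 ?(ltW cad) ?(ltW t0).
by exists t, s; rewrite t0 t1.
Qed.

(** An edge disjoint from cd that meets it does so inside one of the two faces or on ab, which
    [face_crossing] forbids. *)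
Lemma flip_noncrossing : noncrossing p ([set c; d] |: (T :\ [set a; b])).
Proof.
have [sT nc _] := triT.
have bad g k q : [set g; k] \in T -> [set g; k] != [set a; b] ->
    c != g -> c != k -> d != g -> d != k -> segment (p g) (p k) q ->
    segment (p c) (p d) q -> False.
  move=> gkT gkN cg ck dg dk sgk [t [t01 qE]].
  have gk := edge_neq sT gkT.
  have t0 : 0 < t.
    rewrite lt_neqAle (andP t01).1 andbT; apply/eqP=> t0.
    move: sgk; rewrite qE -t0 subr0 scale1r scale0r addr0.
    by case/(vertex_on_segment gp gk) => E; move: cg ck; rewrite E eqxx.
  have t1 : t < 1.
    rewrite lt_neqAle (andP t01).2 andbT; apply/eqP=> t1.
    move: sgk; rewrite qE t1 subrr scale1r scale0r add0r.
    by case/(vertex_on_segment gp gk) => E; move: dg dk; rewrite E eqxx.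
  case: (lerP 0 (orient (p a) (p b) q)) => abq.
    apply: (face_crossing sT nc fc gkT cg ck gkN sgk abq).
      by rewrite qE orient_lerp orient_xx mulr0 add0r mulr_gt0.
    by rewrite qE orient_lerp orient_xx mulr0 add0r mulr_gt0.
  have gkN' : [set g; k] != [set b; a] by rewrite (setUC [set b]).
  apply: (face_crossing sT nc fd gkT dg dk gkN' sgk).
  - by rewrite orient_swap oppr_ge0 ltW.
  - rewrite qE orient_lerp orient_xx mulr0 addr0.
    by apply: mulr_gt0; [rewrite subr_gt0 | rewrite -orient_rot].
  - rewrite qE orient_lerp orient_xx mulr0 addr0.
    by apply: mulr_gt0; [rewrite subr_gt0 | rewrite orient_rot].
move=> i j k l; rewrite !in_setU1 !in_setD1.
move=> /orP[/eqP E1|/andP[N1 T1]] /orP[/eqP E2|/andP[N2 T2]] dis [q [s1 s2]].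
- by move: dis; rewrite E1 E2 -setI_eq0 setIid => /eqP/setP/(_ c); rewrite !inE eqxx.
- move: dis; rewrite E1 disjoint_set2 => /and4P[ck cl dk dl].
  exact: bad T2 N2 ck cl dk dl s2 (segment_set2 E1 s1).
- move: dis; rewrite E2 disjoint_sym disjoint_set2 => /and4P[ck cl dk dl].
  exact: bad T1 N1 ck cl dk dl s1 (segment_set2 E2 s2).
- by apply: (nc i j k l) => //; exists q.
Qed.

(** Where the diagonals cross, ab lies in the plane of the lifted face abc, and cd passes below it
    because d is inside the circle. *)
Lemma flipped_dead T' : [set c; d] \in T' -> dead T' a b.
Proof.
move=> cdT'; have [t [s [t01 s01 E]]] := diagonal.
have [D abT bcT caT _] := fc; have [_ _ adT dbT _] := fd.
have [sT _ _] := triT.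
exists c, d, s, t; split=> //.
- by rewrite disjoint_set2 eq_sym (edge_neq sT caT) (edge_neq sT adT) (edge_neq sT bcT)
    eq_sym (edge_neq sT dbT).
- lra.
- by rewrite (lower_incircle D (esym E)) !incircle_xx; move: illegal; nra.
Qed.

(* Let ij pass above the surface of T where it crosses ab. By linearity it stays
   above on one of the two sides, hence passes above the edge through which it
   leaves the face on that side. *)
Lemma dead_flip T' i j : T :\ [set a; b] \subset T' -> dead T i j -> dead T' i j.
Proof.
move=> /subsetP sT' dead_ij; case: (dead_ij) => k [l [s [t [klT dis s01 E lt]]]].
case: (eqVneq [set k; l] [set a; b]) => [klE|klN]; last first.
  by exists k, l, s, t; split=> //; apply: sT'; rewrite !inE klN.
have [sT nc _] := triT.
have [D abT bcT caT emc] := fc; have [_ _ adT dbT emd] := fd.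
have ab := edge_neq sT abT; have bc := edge_neq sT bcT; have ca := edge_neq sT caT.
have ad := edge_neq sT adT; have db := edge_neq sT dbT.
have sides e : e \in T -> (c \in e) || (d \in e) -> e \in T'.
  move=> eT cde; apply: sT'; rewrite !inE eT andbT; apply: contraTneq cde => ->.
  by rewrite !inE !negb_or ca (eq_sym c) bc (eq_sym d) ad db.
have bcT' : [set b; c] \in T' by apply: sides; rewrite // !inE eqxx orbT.
have caT' : [set c; a] \in T' by apply: sides; rewrite // !inE eqxx.
have adT' : [set a; d] \in T' by apply: sides; rewrite // !inE eqxx !orbT.
have dbT' : [set d; b] \in T' by apply: sides; rewrite // !inE eqxx !orbT.
move: dis; rewrite klE disjoint_set2 => /and4P[ia ib ja jb].
set x := (1 - s) *: p i + s *: p j in E.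
have sx : segment (p a) (p b) x.
  by apply: segment_set2 klE _; exists t; split=> //; case/andP: s01.
(* Heights are measured from the plane of the lifted face abc, in which ab lies. *)
have above : 0 < (1 - s) * inc a b c i + s * inc a b c j.
  move: lt; rewrite (lower_incircle D E).
  have [E1 E2] : inc a b c k = 0 /\ inc a b c l = 0.
    by case/set2_eq: klE => -[-> ->]; rewrite !incircle_xx.
  by rewrite E1 E2; lra.
clear lt E klE klT dead_ij.
(* The endpoints are named so that i' is on the same side of ab as c. *)
have key i' j' s' : a != i' -> b != i' -> a != j' -> b != j' -> 0 <= s' <= 1 ->
    x = (1 - s') *: p i' + s' *: p j' -> 0 < o a b i' ->
    0 < (1 - s') * inc a b c i' + s' * inc a b c j' -> dead T' i' j'.
  move=> ai bi aj bj s'01 xE abi pos.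
  have abx := segment_orient sx.
  have abj : o a b j' < 0.
    have abj0 : o a b j' != 0 by apply: gp.
    rewrite lt_neqAle abj0 leNgt; apply/negP=> abj.
    by have := lerp_gt0 s'01 abi abj; rewrite -orient_lerp -xE abx ltxx.
  have ci : c != i' \/ c = i' by case: (eqVneq c i'); [right | left].
  have cj : c != j' by apply: contraTneq D => ->; rewrite -leNgt ltW.
  have di : d != i' by apply: contraTneq abi => <-; rewrite -leNgt ltW.
  have [bcx cax adx dbx] : [/\ 0 <= orient (p b) (p c) x, 0 <= orient (p c) (p a) x,
      0 <= orient (p a) (p d) x & 0 <= orient (p d) (p b) x].
    have bca : 0 < o b c a by rewrite -orient_rot.
    have cab : 0 < o c a b by rewrite orient_rot.
    have adb : 0 < o a d b by rewrite -orient_rot orient_swap oppr_gt0.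
    have dba : 0 < o d b a by rewrite orient_rot orient_swap oppr_gt0.
    case: sx => u [u01 ->]; rewrite !orient_lerp !orient_xx !mulr0 !add0r !addr0.
    case/andP: u01 => u0 u1; rewrite -subr_ge0 in u1.
    by split; apply: mulr_ge0 => //; apply: ltW.
  have witness u v r : [set u; v] \in T' -> u != i' -> v != i' -> u != j' -> v != j' ->
      0 <= r <= 1 -> segment (p u) (p v) ((1 - r) *: p i' + r *: p j') ->
      inc a b c u <= 0 -> inc a b c v <= 0 ->
      0 < (1 - r) * inc a b c i' + r * inc a b c j' -> dead T' i' j'.
    move=> uvT ui vi uj vj r01 [w [w01 wE]] incu incv posr.
    exists u, v, r, w; split=> //.
    - by rewrite disjoint_set2 !(eq_sym i') !(eq_sym j') ui vi uj vj.
    - by rewrite r01 w01.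
    - by rewrite (lower_incircle D wE); apply: le_lt_trans posr; apply: lerp_le0.
  (* Towards i' the chord leaves abc through bc or ca: there it passes above that side, or it has
     come down to the plane of abc. *)
  have : dead T' i' j' \/ exists2 s1, 0 <= s1 <= s' &
      (1 - s1) * inc a b c i' + s1 * inc a b c j' <= 0.
    case: ci => [ci|<-]; last first.
      right; exists 0; first by rewrite lexx; case/andP: s'01.
      by rewrite incircle_xx mulr0 mul0r addr0.
    have neg : [\/ o a b i' < 0, o b c i' < 0 | o c a i' < 0].
      have bci0 : o b c i' != 0 by apply: gp.
      have cai0 : o c a i' != 0 by apply: gp.
      case: (ltrP (o b c i') 0) => [|le2]; first by constructor 2.
      case: (ltrP (o c a i') 0) => [|le3]; first by constructor 3.
      by case: (emc i'); rewrite !lt_neqAle (ltW abi) le2 le3 !(eq_sym 0) bci0 cai0 gt_eqF.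
    have abx0 : 0 <= orient (p a) (p b) x by rewrite abx.
    have [u [u01]] := triangle_exit D abx0 bcx cax neg.
    rewrite xE lerp_lerp; set s1 := s' * (1 - u) => side.
    have s101 : 0 <= s1 <= s' by apply: param_towards_0.
    case: (lerP ((1 - s1) * inc a b c i' + s1 * inc a b c j') 0) => [le|pos1]; first by right; exists s1.
    left; have s101' : 0 <= s1 <= 1.
      by case/andP: s101 s'01 => -> le1 /andP[_]; apply: le_trans.
    case: side => -[sr neg']; first by rewrite ltNge ltW in neg'.
      by apply: (witness b c s1) => //; rewrite !incircle_xx.
    by apply: (witness c a s1) => //; rewrite !incircle_xx.
  case=> [//|[s1 s101 le]].
  have beyond s2 : s' <= s2 -> 0 < (1 - s2) * inc a b c i' + s2 * inc a b c j'.
    by move=> s2s; apply: affine_beyond le pos => //; case/andP: s101.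
  (* In the second case the chord stays above the plane of abc all the way towards j'. As d is below
     this plane, the same plane serves for the sides ad and db. *)
  have incd : inc a b c d <= 0 by rewrite ltW.
  case: (eqVneq d j') => [E|dj].
    have s'1 : s' <= 1 by case/andP: s'01.
    by have := beyond 1 s'1; rewrite -E subrr mul0r add0r mul1r ltNge incd.
  have neg : [\/ o b a j' < 0, o a d j' < 0 | o d b j' < 0].
    have adj0 : o a d j' != 0 by apply: gp.
    have dbj0 : o d b j' != 0 by apply: gp.
    have baj : 0 < o b a j' by rewrite orient_swap oppr_gt0.
    case: (ltrP (o a d j') 0) => [|le2]; first by constructor 2.
    case: (ltrP (o d b j') 0) => [|le3]; first by constructor 3.
    by case: (emd j'); rewrite !lt_neqAle (ltW baj) le2 le3 !(eq_sym 0) adj0 dbj0 gt_eqF.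
  have D' : 0 < o b a d by rewrite orient_swap oppr_gt0.
  have bax0 : 0 <= orient (p b) (p a) x by rewrite orient_swap abx oppr0.
  have [u [u01]] := triangle_exit D' bax0 adx dbx neg.
  have -> : (1 - u) *: x + u *: p j' =
      (1 - (s' + u * (1 - s'))) *: p i' + (s' + u * (1 - s')) *: p j'.
    by rewrite xE; apply/rowP=> e; rewrite !mxE; ring.
  set s2 := s' + _ => side.
  have /andP[s2s s21] : s' <= s2 <= 1 by apply: param_towards_1.
  have s201 : 0 <= s2 <= 1 by rewrite s21 (le_trans _ s2s) //; case/andP: s'01.
  have pos2 := beyond s2 s2s.
  case: side => -[sr neg']; first by rewrite ltNge orient_swap oppr_ge0 ltW in neg'.
    by apply: (witness a d s2) => //; rewrite ?incircle_xx.
  by apply: (witness d b s2) => //; rewrite ?incircle_xx.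
have s01' : 0 <= s <= 1 by case/andP: s01.
have [ai bi aj bj] : [/\ a != i, b != i, a != j & b != j].
  by rewrite !(eq_sym a) !(eq_sym b).
have abi0 : o a b i != 0 by apply: gp.
have abj0 : o a b j != 0 by apply: gp.
case: (ltrP 0 (o a b i)) => [abi|abi]; first exact: (key i j s).
apply: deadC; apply: (key j i (1 - s)) => //.
- by case/andP: s01' => s0 s1; rewrite subr_ge0 s1 gerBl.
- by rewrite /x addrC; congr (_ *: _ + _ *: _); ring.
- have abi_lt : o a b i < 0 by rewrite lt_neqAle abi0.
  rewrite lt_neqAle eq_sym abj0 leNgt /=; apply/negP=> abj.
  by have := lerp_lt0 s01' abi_lt abj; rewrite -orient_lerp -/x (segment_orient sx) ltxx.
- by move: above; congr (_ < _); ring.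
Qed.

End IllegalEdge.
End Flip.

(** * Legal triangulations are constrained Delaunay *)

Section Crossing.
Variable R : realType.
Implicit Types a b c d e x m : 'rV[R]_2.

Lemma crossing_point a b c d : orient a b c < 0 -> 0 < orient a b d ->
  0 < orient c d a -> orient c d b < 0 ->
  let t := - orient a b c / (orient a b d - orient a b c) in
  segment a b ((1 - t) *: c + t *: d).
Proof.
move=> abc abd cda cdb t.
have NE : orient c d a - orient c d b = orient a b d - orient a b c by rewrite /orient; ring.
have N0 : 0 < orient a b d - orient a b c by lra.
exists (orient c d a / (orient a b d - orient a b c)); split.
  apply/andP; split; first by rewrite divr_ge0 ?(ltW cda) ?(ltW N0).
  by rewrite ler_pdivrMr // -NE; lra.
have N1 := lt0r_neq0 N0.
have -> : 1 - t = orient a b d / (orient a b d - orient a b c) by rewrite /t; field.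
have -> : 1 - orient c d a / (orient a b d - orient a b c) =
    - orient c d b / (orient a b d - orient a b c).
  by rewrite -[1](divff N1) -{1}NE -mulrBl; congr (_ / _); ring.
rewrite /t; apply: rV2_eq; rewrite !mxE !(mulrAC _ _^-1) -!mulrDl; congr (_ / _);
  by rewrite /orient; ring.
Qed.

(** Radical axis: the powers of m with respect to two circles through a and b differ by a multiple
    of [orient a b m]; the factor is found by putting m = c. *)
Lemma incircle_adjacent a b e c m :
  incircle a b c m * orient b a e =
  incircle b a e m * orient a b c - incircle b a e c * orient a b m.
Proof. rewrite /incircle /orient; ring. Qed.

Lemma plucker_m x m u v w :
  orient m u w * orient x m v = orient m v w * orient x m u + orient m u v * orient x m w.
Proof. rewrite /orient; ring. Qed.

Lemma plucker_v x m u v w :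
  orient u v m * orient w v x - orient u v x * orient w v m = orient u v w * orient x m v.
Proof. rewrite /orient; ring. Qed.

Lemma plucker_u x m u v w :
  orient u v m * orient u w x - orient u v x * orient u w m = - (orient u v w * orient x m u).
Proof. rewrite /orient; ring. Qed.

End Crossing.

Section LegalTriangulations.
Variables (R : realType) (n : nat) (p : 'I_n -> 'rV[R]_2).
Hypothesis gp : general_position p.
Variables (T F : edges n).
Hypothesis triT : triangulation p T.

Local Notation o i j k := (orient (p i) (p j) (p k)).
Local Notation inc a b c d := (incircle (p a) (p b) (p c) (p d)).

Definition legal := forall a b c d, [set a; b] \notin F ->
  face p T a b c -> face p T b a d -> 0 <= inc a b c d.

Hypothesis legalT : legal.

(** * The walk through the faces from ab to a visible point m *)

Section March.
Variables (a b m : 'I_n) (s : R).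
Hypotheses (abm : 0 < o a b m) (vis : visible_to p F a b m) (s01 : 0 < s < 1).
Let x := (1 - s) *: p a + s *: p b.
Hypothesis xN : forall w, w != m -> orient x (p m) (p w) != 0.

(* The face uvw is entered by the ray from x to m through the edge uv. *)
Let state (f : 'I_n * 'I_n * 'I_n) := let: (u, v, w) := f in
  [/\ face p T u v w, 0 < orient x (p m) (p u) /\ orient x (p m) (p v) < 0,
      orient (p u) (p v) x <= 0, 0 < o u v m & inc u v w m < 0].

(** The parameter at which the ray from x to m crosses the line uv. *)
Let entry (f : 'I_n * 'I_n * 'I_n) : R := let: (u, v, w) := f in
  - orient (p u) (p v) x / (o u v m - orient (p u) (p v) x).

(** The ray crosses gk later than t and inside the triangle abm, so visibility puts gk outside F.
    Legality of gk and [incircle_adjacent] then place m inside the circle of the next face. *)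
Let march_step g k e t : face p T k g e -> 0 < orient x (p m) (p g) ->
  orient x (p m) (p k) < 0 -> 0 < o g k m -> 0 <= t <= 1 ->
  (1 - t) * orient (p g) (p k) x + t * o g k m < 0 -> inc k g e m < 0 ->
  exists f, state f /\ t < entry f.
Proof.
move=> fe xg xk gkm t01 neg inm.
have [_ kgT _ _ _] := fe.
have gkT : [set g; k] \in T by rewrite setUC.
have gkx : orient (p g) (p k) x < 0 by nra.
have N0 : 0 < o g k m - orient (p g) (p k) x by lra.
pose t' := - orient (p g) (p k) x / (o g k m - orient (p g) (p k) x).
have tt' : t < t' by rewrite ltr_pdivlMr //; lra.
have t'1 : t' < 1 by rewrite ltr_pdivrMr //; lra.
have gkF : [set k; g] \notin F.
  apply/negP=> kgF; apply: (vis kgF); exists ((1 - t') *: x + t' *: p m); split.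
    exact/segmentC/crossing_point.
  exists ((1 - t') * (1 - s)), ((1 - t') * s), t'; split.
  - by apply: mulr_gt0; rewrite subr_gt0 //; case/andP: s01.
  - by apply: mulr_gt0; [rewrite subr_gt0 | case/andP: s01].
  - by apply: le_lt_trans tt'; case/andP: t01.
  - by ring.
  - by apply/rowP=> i; rewrite !mxE; ring.
have [w' fw'] := face_exists gp triT gkT gkm.
exists (g, k, w'); split=> //; split=> //; first exact: ltW.
have leg := legalT gkF fe fw'.
have := incircle_adjacent (p g) (p k) (p e) (p w') (p m).
have [D' _ _ _ _] := fw'; have [D _ _ _ _] := fe => E.
rewrite -(pmulr_llt0 _ D) E subr_lt0.
by apply: lt_le_trans (mulr_ge0 leg (ltW gkm)); rewrite pmulr_llt0.
Qed.

(** A state with the latest entry has no successor. But m is neither w nor inside the face, so the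
    ray leaves through uw or wv, according to the side of the ray on which w lies, and [march_step]
    gives a later state. *)
Let march_end f0 : state f0 -> False.
Proof.
move=> sf0; have [[[u v] w] [sf maxf]] := @ex_max R _ state entry f0 sf0.
have [fuv [xu xv] uvx uvm inm] := sf.
have [D uvT vwT wuT em] := fuv.
have [sT _ _] := triT.
have wu := edge_neq sT wuT; have vw := edge_neq sT vwT.
have N0 : 0 < o u v m - orient (p u) (p v) x by lra.
pose t := entry (u, v, w).
have tE : t = - orient (p u) (p v) x / (o u v m - orient (p u) (p v) x) by [].
have t1E : 1 - t = o u v m / (o u v m - orient (p u) (p v) x).
  by rewrite tE; field; rewrite lt0r_neq0.
have t01 : 0 <= t <= 1.
  apply/andP; split; first by rewrite tE divr_ge0 ?(ltW N0) ?oppr_ge0.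
  by rewrite -subr_ge0 t1E divr_ge0 ?(ltW N0) ?(ltW uvm).
have no_step f : state f -> t < entry f -> False.
  by move=> sf' lt; have := maxf f sf'; rewrite leNgt lt.
have wm : w != m by apply: contraTneq inm => <-; rewrite incircle_xx ltxx.
have um : u != m by apply: contraTneq uvm => <-; rewrite orient_xx ltxx.
have vm : v != m by apply: contraTneq uvm => <-; rewrite orient_xx ltxx.
have Pm := plucker_m x (p m) (p u) (p v) (p w).
have muv : o m u v = o u v m by rewrite orient_rot.
have := xN wm; rewrite neq_lt => /orP[xw|xw].
  have uwm : 0 < o u w m.
    have uwm0 : o u w m != 0 by apply: gp; rewrite // eq_sym.
    rewrite lt_neqAle eq_sym uwm0 leNgt; apply/negP=> neg.
    have muw : o m u w < 0 by rewrite orient_rot.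
    apply: (em m); split=> //; last by rewrite orient_swap oppr_gt0.
    rewrite -orient_rot -(pmulr_lgt0 _ xu); have : 0 < o m u w * orient x (p m) (p v) by rewrite nmulr_rgt0.
    have : o m u v * orient x (p m) (p w) < 0 by rewrite muv pmulr_rlt0.
    by move: Pm; lra.
  have [||f [sf' lt]] := @march_step u w v t (face_rot (face_rot fuv)) xu xw uwm t01; last exact: no_step sf' lt.
    rewrite t1E tE -(pmulr_llt0 _ N0).
    have -> : (o u v m / (o u v m - orient (p u) (p v) x) * orient (p u) (p w) x +
      - orient (p u) (p v) x / (o u v m - orient (p u) (p v) x) * o u w m) *
      (o u v m - orient (p u) (p v) x) = o u v m * orient (p u) (p w) x - orient (p u) (p v) x * o u w m.
      by field; rewrite lt0r_neq0.
    by rewrite plucker_u oppr_lt0 mulr_gt0.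
  by rewrite incircle_rot.
have wvm : 0 < o w v m.
  have wvm0 : o w v m != 0 by apply: gp; rewrite // eq_sym.
  rewrite lt_neqAle eq_sym wvm0 leNgt; apply/negP=> neg.
  have vwm : 0 < o v w m by rewrite orient_swap oppr_gt0.
  apply: (em m); split=> //.
  have mvw : 0 < o m v w by rewrite orient_rot.
  have : 0 < o m v w * orient x (p m) (p u) by rewrite mulr_gt0.
  have : 0 < o m u v * orient x (p m) (p w) by rewrite muv mulr_gt0.
  move=> h1 h2; have : 0 < o m u w * orient x (p m) (p v) by move: Pm; lra.
  by rewrite nmulr_lgt0 // -oppr_gt0 -orient_swap orient_rot orient_rot -orient_rot.
have [||f [sf' lt]] := @march_step w v u t (face_rot fuv) xw xv wvm t01; last exact: no_step sf' lt.
  rewrite t1E tE -(pmulr_llt0 _ N0).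
  have -> : (o u v m / (o u v m - orient (p u) (p v) x) * orient (p w) (p v) x +
    - orient (p u) (p v) x / (o u v m - orient (p u) (p v) x) * o w v m) *
    (o u v m - orient (p u) (p v) x) = o u v m * orient (p w) (p v) x - orient (p u) (p v) x * o w v m.
    by field; rewrite lt0r_neq0.
  by rewrite plucker_v pmulr_rlt0.
by rewrite -incircle_rot.
Qed.

Lemma march_incircle c : face p T a b c -> 0 <= inc a b c m.
Proof.
move=> fc; rewrite leNgt; apply/negP=> inm; apply: (march_end (f0 := (a, b, c))).
split=> //.
- have xE w : orient x (p m) w = orient (p m) w x by rewrite orient_rot.
  rewrite !xE /x !orient_lerp !orient_xx.
  have E1 : o m a b = o a b m by rewrite orient_rot.
  have E2 : o m b a = - o a b m by rewrite orient_rot orient_swap.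
  case/andP: s01 => s0 s1; rewrite E1 E2 !mulr0 add0r addr0 mulrN oppr_lt0.
  by split; apply: mulr_gt0 => //; rewrite subr_gt0.
- by rewrite /x orient_lerp !orient_xx; lra.
Qed.

End March.

Lemma visible_incircle a b c m : face p T a b c -> 0 < o a b m -> visible_to p F a b m ->
  0 <= inc a b c m.
Proof.
move=> fc abm vis; have [sT _ _] := triT; have [_ abT _ _ _] := fc.
have ab := edge_neq sT abT.
have am : a != m by apply: contraTneq abm => <-; rewrite orient_xx ltxx.
have bm : b != m by apply: contraTneq abm => <-; rewrite orient_xx ltxx.
(* [orient x (p m) (p w)] is affine in s and, for w other than a and m, can vanish only if s is at
   least [f w]. A smaller s puts x so close to a that the line xm avoids all other vertices. *)
pose f w := `|o a m w| / (`|o a m w| + `|o b m w|).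
have b0 : b != a /\ b != m by rewrite eq_sym.
have [w0 [[w0a w0m] minf]] := @ex_min R _ (fun w => w != a /\ w != m) f b b0.
have f_gt0 w : w != a -> w != m -> 0 < f w /\ 0 < `|o a m w| + `|o b m w|.
  move=> wa wm; have pos : 0 < `|o a m w|.
    by rewrite normr_gt0; apply: gp; rewrite // eq_sym.
  have pos2 : 0 < `|o a m w| + `|o b m w| by rewrite ltr_wpDr.
  by split=> //; rewrite divr_gt0.
have [f0 _] := f_gt0 w0 w0a w0m.
pose s := Num.min (f w0) 1 / 2.
have [s0 s1 sf] : [/\ 0 < s, s < 1 & s < f w0].
  rewrite /s; case: (lerP (f w0) 1) => le; split; lra.
have s01 : 0 < s < 1 by rewrite s0 s1.
apply: (march_incircle abm vis s01) => // w wm.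
have -> : orient ((1 - s) *: p a + s *: p b) (p m) (p w) = (1 - s) * o a m w + s * o b m w.
  by rewrite /orient !mxE; ring.
case: (eqVneq w a) => [->|wa].
  rewrite orient_xx mulr0 add0r mulf_neq0 ?(gt_eqF s0) //.
  by apply: gp; rewrite // eq_sym.
have [fw d0] := f_gt0 w wa wm.
apply/eqP=> E.
have ltf : s * (`|o a m w| + `|o b m w|) < `|o a m w|.
  by rewrite -ltr_pdivlMr //; apply: lt_le_trans sf _; apply: minf.
have : `|o a m w| <= s * (`|o a m w| + `|o b m w|); last by rewrite leNgt ltf.
have AE : o a m w = s * (o a m w - o b m w) by lra.
rewrite {1}AE normrM (gtr0_norm s0) ler_pM2l //.
exact: ler_normB.
Qed.

End LegalTriangulations.

Section Circles.
Variable R : realType.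
Implicit Types a b c m : 'rV[R]_2.

Lemma sqdistE a b : sqdist a b = (a 0 0 - b 0 0) ^+ 2 + (a 0 1 - b 0 1) ^+ 2.
Proof.
rewrite /sqdist !big_ord_recl big_ord0 addr0.
by have -> : lift ord0 ord0 = 1 :> 'I_2 by apply/val_inj.
Qed.

Lemma sqdist_ge0 a b : 0 <= sqdist a b.
Proof. by rewrite sqdistE addr_ge0 ?sqr_ge0. Qed.

Lemma sqdist_eq0 a b : sqdist a b = 0 -> a = b.
Proof.
rewrite sqdistE => /eqP; rewrite paddr_eq0 ?sqr_ge0 // !sqrf_eq0 !subr_eq0.
by case/andP=> /eqP e0 /eqP e1; apply: rV2_eq.
Qed.

(** The centre comes from Cramer's rule, and [incircle a b c m / orient a b c] is the power of m
    with respect to the circle. *)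
Lemma circumcircle a b c : 0 < orient a b c ->
  exists o r, 0 < r /\ forall m, sqdist o m = r ^+ 2 + incircle a b c m / orient a b c.
Proof.
move=> D0; have DN := lt0r_neq0 D0.
pose o : 'rV[R]_2 := \row_k (if k == 0
  then (lift_height a * (b 0 1 - c 0 1) + lift_height b * (c 0 1 - a 0 1) +
        lift_height c * (a 0 1 - b 0 1)) / (2 * orient a b c)
  else (lift_height a * (c 0 0 - b 0 0) + lift_height b * (a 0 0 - c 0 0) +
        lift_height c * (b 0 0 - a 0 0)) / (2 * orient a b c)).
have E m : sqdist o m = sqdist o a + incircle a b c m / orient a b c.
  rewrite !sqdistE !mxE /=; move: DN; rewrite /incircle /lift_height /orient => DN.
  by field.
have S0 : 0 < sqdist o a.
  rewrite lt_neqAle sqdist_ge0 andbT eq_sym; apply/eqP=> S0.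
  have oa := sqdist_eq0 S0; have := E b.
  rewrite S0 incircle_xx mul0r addr0 => /sqdist_eq0 ob.
  by move: D0; rewrite -oa -ob orient_xx ltxx.
exists o, (Num.sqrt (sqdist o a)); rewrite sqrtr_gt0 sqr_sqrtr ?sqdist_ge0 //.
Qed.

End Circles.

Section LegalDelaunay.
Variables (R : realType) (n : nat) (p : 'I_n -> 'rV[R]_2).
Hypothesis gp : general_position p.
Hypothesis inj : injective p.
Variables (T F : edges n).
Hypothesis triT : triangulation p T.
Hypothesis sFT : F \subset T.
Hypothesis legalT : legal p T F.

Local Notation o i j k := (orient (p i) (p j) (p k)).
Local Notation inc a b c d := (incircle (p a) (p b) (p c) (p d)).

Lemma triangulation_visible a b : [set a; b] \in T -> [set a; b] \notin F -> visible p F a b.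
Proof.
move=> abT abF k l klF [x [[[t [t01 xkl]] [s [s01 xab]]] _]].
have [sT nc _] := triT.
have klT := subsetP sFT _ klF; have ab := edge_neq sT abT.
have skl : segment (p k) (p l) x by exists t; split=> //; lra.
have sab : segment (p a) (p b) x by exists s; split=> //; lra.
case: (edges_meet gp sT nc klT abT skl sab) => [E|[v [_ vab xv]]]; first by rewrite -E klF in abF.
suff /eqP : p a = p b by rewrite (inj_eq inj) (negPf ab).
have E (e : 'I_2) : p v 0 e = (1 - s) * p a 0 e + s * p b 0 e by rewrite -xv xab !mxE.
apply/rowP=> e; have := E e; case: vab => ->.
  by move=> H; apply: (@mulfI _ s); [lra | lra].
by move=> H; apply: (@mulfI _ (1 - s)); [lra | lra].
Qed.

Lemma visible_toC a b m : visible_to p F a b m -> visible_to p F b a m.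
Proof.
move=> vis k l klF [x [skl [u [v [w [u0 v0 w0 sum xE]]]]]]; apply: (vis k l klF).
by exists x; split=> //; exists v, u, w; split; rewrite // ?(addrC v) // xE (addrC (u *: _)).
Qed.

(** The circle is that of abc. For m on the other side of ab the walk starts in the face across ab,
    and legality of ab with [incircle_adjacent] carries the result over. *)
Lemma circle_of_face a b c : [set a; b] \notin F -> face p T a b c ->
  constrained_empty_circle p F a b.
Proof.
move=> abF fc; have [D abT _ _ _] := fc; have [sT _ _] := triT.
have ab := edge_neq sT abT.
have [ctr [r [r0 E]]] := circumcircle D.
exists ctr, r; split; rewrite ?E ?incircle_xx ?mul0r ?addr0 // => m vis.
apply/negP; rewrite -leNgt E lerDl divr_ge0 ?(ltW D) //.
case: (eqVneq m a) => [->|ma]; first by rewrite incircle_xx.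
case: (eqVneq m b) => [->|mb]; first by rewrite incircle_xx.
have := @gp a b m ab; rewrite (eq_sym b) (eq_sym a m) => /(_ mb ma).
rewrite neq_lt => /orP[abm|abm]; last exact: (visible_incircle gp triT legalT fc abm vis).
have bam : 0 < o b a m by rewrite orient_swap oppr_gt0.
have baT : [set b; a] \in T by rewrite setUC.
have [d fd] := face_exists gp triT baT bam.
have leg := legalT abF fc fd.
have far := visible_incircle gp triT legalT fd bam (visible_toC vis).
have [D' _ _ _ _] := fd.
have := incircle_adjacent (p b) (p a) (p c) (p d) (p m) => adj.
rewrite -(pmulr_lge0 _ D').
have -> : inc a b c m * o b a d = inc b a d m * o a b c + inc a b c d * o b a m by rewrite adj; ring.
by rewrite addr_ge0 ?mulr_ge0 ?(ltW D) ?(ltW bam).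
Qed.

Lemma constrained_empty_circleC a b :
  constrained_empty_circle p F a b -> constrained_empty_circle p F b a.
Proof.
case=> ctr [r [r0 ra rb em]]; exists ctr, r; split=> // m /visible_toC; exact: em.
Qed.

Lemma legal_empty_circle a b : [set a; b] \in T -> [set a; b] \notin F ->
  constrained_empty_circle p F a b.
Proof.
move=> abT abF; have [sT _ _] := triT; have ab := edge_neq sT abT.
have baT : [set b; a] \in T by rewrite setUC.
have baF : [set b; a] \notin F by rewrite setUC.
case: (pickP (fun m => 0 < o a b m)) => [m abm|left0].
  by have [c fc] := face_exists gp triT abT abm; apply: circle_of_face fc.
case: (pickP (fun m => 0 < o b a m)) => [m bam|right0].
  have [c fc] := face_exists gp triT baT bam.
  by apply: constrained_empty_circleC; apply: circle_of_face fc.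
(* No point lies on either side of ab, so a and b are the only points and the circle with diameter
   ab is empty. *)
pose ctr := (1 / 2) *: (p a + p b).
have E : sqdist ctr (p b) = sqdist ctr (p a) by rewrite !sqdistE !mxE; field.
have S0 : 0 < sqdist ctr (p a).
  rewrite lt_neqAle sqdist_ge0 andbT eq_sym; apply/eqP=> S0.
  case/eqP: ab; apply: inj; rewrite -(sqdist_eq0 S0).
  by apply: sqdist_eq0; rewrite E.
exists ctr, (Num.sqrt (sqdist ctr (p a))).
rewrite sqrtr_gt0 sqr_sqrtr ?sqdist_ge0 //; split=> // m _.
case: (eqVneq m a) => [->|ma]; first by rewrite ltxx.
case: (eqVneq m b) => [->|mb]; first by rewrite E ltxx.
have := @gp a b m ab; rewrite (eq_sym b) (eq_sym a m) => /(_ mb ma).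
by rewrite neq_lt left0 orbF -oppr_gt0 -orient_swap right0.
Qed.

Lemma legal_subset_CDT T0 : constrained_Delaunay_triangulation p F T0 -> T \subset T0.
Proof.
move=> [_ cdt]; have [sT _ _] := triT; apply/subsetP=> e eT.
have : e \in complete_graph n by apply: (subsetP sT).
rewrite inE => /cards2P[i [j [ij eE]]]; rewrite eE in eT *.
apply/cdt => //; case: (boolP ([set i; j] \in F)) => ijF; [by left | right].
by split; [apply: triangulation_visible | apply: legal_empty_circle].
Qed.

End LegalDelaunay.

(** * Generic points are in general position *)

Section GenericPosition.
Variables (R : realType) (n : nat).
Implicit Types (q : 'I_n -> 'rV[R]_2) (E : edges n).

Lemma rigidity_row_entry q u w v (k : 'I_2) : u != w ->
  rigidity_row q [set u; w] 0 (mxvec_index v k) =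
  (v == u)%:R * (q u 0 k - q w 0 k) + (v == w)%:R * (q w 0 k - q u 0 k).
Proof.
move=> uw; rewrite /rigidity_row mxvecE mxE big_setU1 ?inE //= big_set1.
case: (eqVneq v u) => [->|vu] /=; first by rewrite (negPf uw) /=; ring.
by case: (eqVneq v w) => [->|vw] /=; ring.
Qed.

Lemma mul_rigidity_matrix q E (c : 'rV[R]_#|E|) (f : edge n -> R) :
  (forall r, c 0 r = f (enum_val r)) ->
  c *m rigidity_matrix q E = \sum_(e in E) f e *: rigidity_row q e.
Proof.
move=> cE; rewrite mulmx_sum_row [RHS]big_enum_val; apply: eq_bigr => r _.
by rewrite cE rowK.
Qed.

(** Three collinear points carry a nonzero stress, so the three rows at p are dependent, whereas a
    proper triangle has rank 3. *)
Lemma generic_general_position (p : 'I_n -> 'rV[R]_2) :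
  injective p -> generic p -> general_position p.
Proof.
move=> inj gen i j k ij jk ik; apply/eqP=> ijk0.
have neq1 : [set i; j] != [set j; k].
  by apply/eqP=> /set2_eq[] [] E1 E2; move: ij ik; rewrite E1 eqxx.
have neq2 : [set i; j] != [set i; k].
  by apply/eqP=> /set2_eq[] [] E1 E2; move: jk ik; rewrite ?E1 ?E2 eqxx.
have neq3 : [set j; k] != [set i; k].
  by apply/eqP=> /set2_eq[] [] E1 E2; move: ij jk; rewrite ?E1 ?E2 eqxx.
pose E : edges n := [set i; j] |: ([set j; k] |: [set [set i; k]]).
have sE : E \subset complete_graph n.
  by rewrite !subUset !sub1set !inE !cards2 ij jk ik.
have sumE q (f : edge n -> R) : \sum_(e in E) f e *: rigidity_row q e =
    f [set i; j] *: rigidity_row q [set i; j] + (f [set j; k] *: rigidity_row q [set j; k] +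
    f [set i; k] *: rigidity_row q [set i; k]).
  by rewrite !big_setU1 ?big_set1 ?inE ?negb_or ?neq1 ?neq2 ?neq3.
have entry q (f : edge n -> R) v (e : 'I_2) : (\sum_(e in E) f e *: rigidity_row q e) 0 (mxvec_index v e) =
    f [set i; j] * ((v == i)%:R * (q i 0 e - q j 0 e) + (v == j)%:R * (q j 0 e - q i 0 e)) +
    (f [set j; k] * ((v == j)%:R * (q j 0 e - q k 0 e) + (v == k)%:R * (q k 0 e - q j 0 e)) +
     f [set i; k] * ((v == i)%:R * (q i 0 e - q k 0 e) + (v == k)%:R * (q k 0 e - q i 0 e))).
  by rewrite sumE !mxE !rigidity_row_entry.
have [ji kj ki] : [/\ j == i = false, k == j = false & k == i = false].
  by rewrite !(eq_sym k) (eq_sym j) !(negPf ij) !(negPf jk) !(negPf ik).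
(* A proper triangle: j at (1, 0), k at (0, 1), i and all other vertices at the origin. *)
pose q v : 'rV[R]_2 := \row_e (if v == j then (e == 0)%:R else (v == k)%:R * (e == 1)%:R).
have ijE : [set i; j] \in E by rewrite !inE eqxx.
have free_q : row_free (rigidity_matrix q E).
  apply: inj_row_free => c c0.
  pose f e := c 0 (enum_rank_in ijE e).
  have cE r : c 0 r = f (enum_val r) by rewrite /f enum_valK_in.
  rewrite (mul_rigidity_matrix q cE) in c0.
  have ent v e := entry q f v e; rewrite c0 in ent.
  have := ent i 0; have := ent i 1; have := ent j 0.
  rewrite !mxE !eqxx /= ji kj (negPf ij) (negPf ik) (negPf jk) /=.
  rewrite !(mul0r, mul1r, mulr0, mulr1, addr0, add0r, subr0, sub0r) => e1 e2 e3.
  have f1 : f [set i; j] = 0 by lra.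
  have f2 : f [set j; k] = 0 by lra.
  have f3 : f [set i; k] = 0 by lra.
  apply/rowP=> r; rewrite cE mxE; have := enum_valP r.
  by rewrite !inE => /or3P[] /eqP->.
have rank_p := gen E q sE; rewrite (eqP free_q) in rank_p.
have free_p : row_free (rigidity_matrix p E) by rewrite /row_free eqn_leq rank_leq_row.
have [t tE] : exists t, forall e : 'I_2, p k 0 e - p i 0 e = t * (p j 0 e - p i 0 e).
  have : p j != p i by rewrite (inj_eq inj) eq_sym.
  move: ijk0; rewrite /orient => ijk0 neq.
  case: (eqVneq (p j 0 0) (p i 0 0)) => [e0|ne0].
    have ne1 : p j 0 1 - p i 0 1 != 0.
      by rewrite subr_eq0; apply: contraNneq neq => e1; apply/eqP; apply: rV2_eq.
    exists ((p k 0 1 - p i 0 1) / (p j 0 1 - p i 0 1)) => e.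
    case: (eqVneq e 0) => [->|en0].
      apply: (mulIf ne1); move: ijk0; rewrite e0; lra.
    have -> : e = 1 by apply/val_inj; case: e en0 => [[|[|]]].
    by rewrite divfK.
  have ne : p j 0 0 - p i 0 0 != 0 by rewrite subr_eq0.
  exists ((p k 0 0 - p i 0 0) / (p j 0 0 - p i 0 0)) => e.
  case: (eqVneq e 0) => [->|en0]; first by rewrite divfK.
  have -> : e = 1 by apply/val_inj; case: e en0 => [[|[|]]].
  by apply: (mulIf ne); rewrite mulrAC divfK //; lra.
have t0 : t != 0.
  apply: contraNneq ik => t0; apply/eqP/inj/rowP=> e.
  by have := tE e; rewrite t0 mul0r => /eqP; rewrite subr_eq0 => /eqP.
(* The equilibrium stress of three collinear points with coordinates 0, 1, t. *)
pose f (e : edge n) : R := if e == [set i; j] then t * (t - 1)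
  else if e == [set j; k] then t else 1 - t.
pose c : 'rV[R]_#|E| := \row_r f (enum_val r).
have cE r : c 0 r = f (enum_val r) by rewrite mxE.
have c0 : c *m rigidity_matrix p E = 0.
  rewrite (mul_rigidity_matrix p cE); apply/rowP=> r.
  case/mxvec_indexP: r => v e; rewrite entry !mxE.
  have [f1 f2 f3] : [/\ f [set i; j] = t * (t - 1), f [set j; k] = t & f [set i; k] = 1 - t].
    have n1 : [set j; k] == [set i; j] = false by rewrite eq_sym (negPf neq1).
    have n2 : [set i; k] == [set i; j] = false by rewrite eq_sym (negPf neq2).
    have n3 : [set i; k] == [set j; k] = false by rewrite eq_sym (negPf neq3).
    by rewrite /f !eqxx n1 n2 n3.
  rewrite f1 f2 f3; have := tE e; set X := p k 0 e; set Y := p j 0 e; set Z := p i 0 e => H.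
  have -> : X = Z + t * (Y - Z) by lra.
  by ring.
have : c == 0 by rewrite -(mulmx_free_eq0 c free_p) c0.
move/eqP=> c00.
have jkE : [set j; k] \in E by rewrite !inE eqxx orbT.
have := cE (enum_rank_in ijE [set j; k]).
rewrite c00 mxE enum_rankK_in // /f eq_sym (negPf neq1) eqxx => /eqP.
by rewrite eq_sym (negPf t0).
Qed.

End GenericPosition.

(** * The sequence of flips *)

Section FlipSequence.
Variables (R : realType) (n : nat) (p : 'I_n -> 'rV[R]_2).
Hypotheses (inj : injective p) (gp : general_position p).
Variables (F T0 : edges n).
Hypothesis cdt : constrained_Delaunay_triangulation p F T0.

Definition dead_edges (T : edges n) : edges n :=
  [set e | `[< exists i j, [/\ i != j, e = [set i; j] & dead p T i j] >]].

Lemma dead_edges_sub T : dead_edges T \subset complete_graph n.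
Proof.
apply/subsetP=> e; rewrite !inE => /asboolP[i [j [ij -> _]]].
by rewrite cards2 ij.
Qed.

(** The flipped set is extended to a maximal one; additional edges do not revive dead segments. The
    edge ab is not dead in T and becomes so. *)
Lemma flip_triangulation T a b c d : triangulation p T -> face p T a b c ->
  face p T b a d -> incircle (p a) (p b) (p c) (p d) < 0 ->
  exists T', [/\ triangulation p T', T :\ [set a; b] \subset T', [set a; b] \notin T' &
    (#|dead_edges T| < #|dead_edges T'|)%N].
Proof.
move=> triT fc fd ill; have [sT nc _] := triT; have [D abT _ _ _] := fc.
have [Dd _ _ _ _] := fd.
have ab := edge_neq sT abT.
have cd : c != d.
  by apply: contraTneq D => ->; rewrite -leNgt -oppr_ge0 -orient_swap ltW.
have sT' : [set c; d] |: (T :\ [set a; b]) \subset complete_graph n.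
  rewrite subUset sub1set inE cards2 cd /=.
  exact: subset_trans (subsetDl _ _) sT.
have [T' triT' sub] := triangulation_extend sT' (flip_noncrossing gp triT fc fd ill).
move: sub; rewrite subUset sub1set => /andP[cdT' sub].
have [_ nc' _] := triT'.
have dead_ab := flipped_dead triT fc fd ill cdT'.
exists T'; split=> //; first exact: dead_notin dead_ab.
apply/proper_card/properP; split.
  apply/subsetP=> e; rewrite !inE => /asboolP[i [j [ij eE dij]]].
  apply/asboolP; exists i, j; split=> //.
  exact: (dead_flip gp triT fc fd ill sub).
exists [set a; b]; first by rewrite inE; apply/asboolP; exists a, b.
rewrite inE; apply/negP=> /asboolP[i [j [ij E /(dead_notin nc)]]].
by rewrite -E abT.
Qed.

(** Induction on m, which bounds the edges not yet dead and hence the flips left. *)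
Lemma flip_sequence m (T L : edges n) : triangulation p T -> L \subset T -> F \subset L ->
  laman_graph L -> (#|complete_graph n| <= #|dead_edges T| + m)%N ->
  exists s : seq (edges n),
    [/\ path (@L_flip n) L s,
        forall M : edges n, M \in s -> constrained_noncrossing_laman p F M,
        CDLF F T0 (last L s) & (size s <= m)%N].
Proof.
elim: m T L => [|m IH] T L triT LT FL lamL le.
all: have FT := subset_trans FL LT.
all: case: (pselect (legal p T F)) => [leg|/existsNP[a]].
all: try by exists [::]; split=> //; split=> //;
  apply: subset_trans LT (legal_subset_CDT gp inj triT FT leg cdt).
all: case/existsNP=> b /existsNP[c] /existsNP[d].
all: case/not_implyP=> abF /not_implyP[fc] /not_implyP[fd] /negP; rewrite -ltNge => ill.
all: have [T' [triT' sub abT' ltd]] := flip_triangulation triT fc fd ill.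
  (* With m = 0 all edges of the complete graph are already dead, which leaves no room for a
     flip. *)
  have := leq_trans ltd (leq_trans (subset_leq_card (dead_edges_sub T')) le).
  by rewrite addn0 ltnn.
have le' : (#|complete_graph n| <= #|dead_edges T'| + m)%N.
  by apply: leq_trans le _; rewrite addnS -addSn leq_add2r.
(* If ab is not in L, only the triangulation changes and no L-flip is spent. *)
case: (boolP ([set a; b] \in L)) => abL; last first.
  have LT' : L \subset T'.
    apply: subset_trans sub; apply/subsetP=> e eL; rewrite !inE (subsetP LT) // andbT.
    by apply: contraNneq abL => <-.
  have [s [ps Ms cs sz]] := IH T' L triT' LT' FL lamL le'.
  by exists s; split=> //; apply: leqW.
have [indL /eqP cardL] := andP lamL.
have [sT _ _] := triT; have [sT' nc' _] := triT'.
have [D abT bcT caT _] := fc.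
have n3 : (2 < n)%N.
  have <- : #|[set a; b; c]| = 3%N.
    rewrite setUC cardsU1 !inE cards2 (edge_neq sT abT) negb_or.
    by rewrite (edge_neq sT caT) eq_sym (edge_neq sT bcT).
  by rewrite -[X in (_ <= X)%N]card_ord max_card.
have indI := laman_independent_sub (subsetDl L [set [set a; b]]) indL.
have cardI : (#|L :\ [set a; b]| + 4 = 2 * n)%N.
  by rewrite -cardL (cardsD1 [set a; b] L) abL addnAC addnC.
have IT' : L :\ [set a; b] \subset T' by apply: subset_trans sub; apply: setSD.
have [|g] := laman_augment n3 indI cardI IT' sT'.
  by move=> B v x y; apply: (star_connected gp triT').
rewrite inE => /andP[gI gT'] indL'.
have gab : g != [set a; b] by apply: contraNneq abT' => <-.
have gL : g \notin L by move: gI; rewrite !inE gab.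
set L' := g |: (L :\ [set a; b]) in indL'.
have lamL' : laman_graph L'.
  by rewrite /laman_graph indL' /L' cardsU1 gI -cardI addnAC addnC eqxx.
have L'T' : L' \subset T' by rewrite subUset sub1set gT'.
have FL' : F \subset L'.
  apply/subsetP=> e eF; rewrite !inE (subsetP FL) // andbT.
  by rewrite (contraNneq _ abF) ?orbT // => <-.
have [s [ps Ms cs sz]] := IH T' L' triT' L'T' FL' lamL' le'.
exists (L' :: s); split=> //=.
- rewrite ps andbT /L_flip lamL lamL' /=.
  apply/existsP; exists [set a; b]; rewrite abL /=.
  by apply/existsP; exists g; rewrite inE gL /= eqxx.
- move=> M; rewrite inE => /orP[/eqP->|]; last exact: Ms.
  split=> // i j k l ijL klL; apply: nc'; exact: (subsetP L'T').
Qed.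

End FlipSequence.

Theorem theorem1 (R : realType) :
  exists C : nat,
  forall (n : nat) (p : 'I_n -> 'rV[R]_2) (F T L : edges n),
    injective p -> generic p ->
    laman_independent F -> noncrossing p F ->
    unique (constrained_Delaunay_triangulation p F) T ->
    constrained_noncrossing_laman p F L ->
    exists s : seq (edges n),
      [/\ path (@L_flip n) L s,
          forall M : edges n, M \in s -> constrained_noncrossing_laman p F M,
          CDLF F T (last L s) &
          (size s <= C * n ^ 2)%N].
Proof.
(* The bound n(n - 1)/2 on the number of flips is at most n^2. *)
exists 1%N => n p F T L inj gen _ _ [cdt _] [lamL FL ncL].
have gp := generic_general_position inj gen.
have sL : L \subset complete_graph n by case/andP: lamL => /andP[].
have [T1 tri1 LT1] := triangulation_extend sL ncL.
apply: (flip_sequence inj gp cdt tri1 LT1 FL lamL).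
rewrite mul1n; apply: leq_trans (leq_addl _ _).
rewrite /complete_graph card_draws card_ord bin2.
by case: n {p F T L inj gen cdt lamL FL ncL gp sL T1 tri1 LT1} => // n; lia.
Qed.
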